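(* Let $n\ge1$, $G=\mathrm{SL}(n+1,\mathbb{C})\times\mathrm{SL}(n+1,\mathbb{C})$, $H=\mathrm{diag}\,\mathrm{SL}(n+1,\mathbb{C})\subset G$. Fix $k\in\mathbb{N}_0$ and set $$B(k\omega_1)=\Bigl\{\sum_{i=1}^{n+1}k_i(\omega_i,\omega_{n+2-i})\ \Big|\ k_i\in\mathbb{N}_0,\ \sum_{i=1}^{n+1}k_i=k\Bigr\}.$$ Then $P^+_G(k\omega_1)=B(k\omega_1)+P^+_G(0)$.
   Context: $\omega_1,\dots,\omega_n$ are the fundamental weights of $\mathrm{SL}(n+1,\mathbb{C})$ (with respect to upper triangular matrices), with the convention $\omega_0=\omega_{n+1}=0$. Highest weights of $G$ are taken with respect to the Borel subgroup $B\times B$, $B\subset\mathrm{SL}(n+1,\mathbb{C})$ upper triangular. For a dominant weight $\mu$ of $H\cong\mathrm{SL}(n+1,\mathbb{C})$, $P^+_G(\mu)$ is the set of dominant weights $\lambda$ of $G$ such that the restriction to $H$ of the irreducible $G$-representation $\pi^G_\lambda$ of highest weight $\lambda$ contains the irreducible $H$-representation $\pi^H_\mu$ of highest weight $\mu$; for $\mu=0$, $P^+_G(0)$ is the semigroup generated by $(\omega_i,\omega_{n+1-i})$, $i=1,\dots,n$. The representation of highest weight $k\omega_1$ is $S^k(\mathbb{C}^{n+1})$. *)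

(* Defs.v *)
From HB Require Import structures.
From mathcomp Require Import all_boot all_order all_algebra.
From mathcomp Require Import mpoly complex.
From mathcomp Require Import classical_sets reals.

Set Implicit Arguments.
Unset Strict Implicit.
Unset Printing Implicit Defensive.

Import Order.TTheory GRing.Theory Num.Theory.
Local Open Scope ring_scope.
Local Open Scope classical_set_scope.

Section SpecialLinearGroup.
Variables (C : fieldType) (m : nat).

Record SL := MkSL { slmx :> 'M[C]_m; _ : \det slmx == 1 }.

HB.instance Definition _ := [isSub for slmx].
HB.instance Definition _ := [Choice of SL by <:].

Lemma det_slmx (g : SL) : \det g = 1.
Proof. by case: g => g /= /eqP. Qed.

Lemma slmx_unit (g : SL) : (g : 'M[C]_m) \in unitmx.
Proof. by rewrite unitmxE det_slmx unitr1. Qed.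

Lemma SL_one_subproof : \det (1%:M : 'M[C]_m) == 1.
Proof. by rewrite det1. Qed.

Lemma SL_inv_subproof (g : SL) : \det (invmx g) == 1.
Proof. by rewrite det_inv det_slmx invr1. Qed.

Lemma SL_mul_subproof (g h : SL) : \det (g *m h) == 1.
Proof. by rewrite det_mulmx !det_slmx mulr1. Qed.

Definition SL_one := MkSL SL_one_subproof.
Definition SL_inv (g : SL) := MkSL (SL_inv_subproof g).
Definition SL_mul (g h : SL) := MkSL (SL_mul_subproof g h).

Lemma SL_mulA : associative SL_mul.
Proof. by move=> f g h; apply/val_inj; rewrite /= mulmxA. Qed.

Lemma SL_mul1 : left_id SL_one SL_mul.
Proof. by move=> g; apply/val_inj; rewrite /= mul1mx. Qed.

Lemma SL_mulr1 : right_id SL_one SL_mul.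
Proof. by move=> g; apply/val_inj; rewrite /= mulmx1. Qed.

Lemma SL_mulV : left_inverse SL_one SL_inv SL_mul.
Proof. by move=> g; apply/val_inj; rewrite /= mulVmx // slmx_unit. Qed.

Lemma SL_mulrV : right_inverse SL_one SL_inv SL_mul.
Proof. by move=> g; apply/val_inj; rewrite /= mulmxV // slmx_unit. Qed.

HB.instance Definition _ :=
  isGroup.Build SL SL_mulA SL_mul1 SL_mulr1 SL_mulV SL_mulrV.

End SpecialLinearGroup.

(* A linear algebraic group is a group together with the closed embedding
   x : G -> C^N whose coordinates generate its algebra of regular functions;
   representations are finite-dimensional and rational. *)
Section Representations.
Variables (C : fieldType) (G : groupType) (N : nat) (x : G -> 'I_N -> C).

Definition regular_fun (f : G -> C) : Prop :=
  exists p : {mpoly C[N]}, forall g, f g = p.@[x g].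

Definition is_rep (V : vectType C) (rho : G -> 'End(V)) : Prop :=
  [/\ rho 1%g = \1%VF,
      forall g h, rho (g * h)%g = (rho g \o rho h)%VF
    & forall (f : 'Hom(V, C^o)) (v : V), regular_fun (fun g => f (rho g v))].

Definition irreducible_rep (V : vectType C) (rho : G -> 'End(V)) : Prop :=
  [/\ is_rep rho, (fullv : {vspace V}) <> 0%VS
    & forall U : {vspace V}, (forall g, (rho g @: U <= U)%VS) ->
        U = 0%VS \/ U = fullv].

(* [B] is a Borel subgroup and [chi] is a character of [B]; the values of [chi]
   outside [B] are not used. *)
Definition has_highest_weight (B : set G) (chi : G -> C)
    (V : vectType C) (rho : G -> 'End(V)) : Prop :=
  exists2 v : V, v != 0 & forall b, B b -> rho b v = chi b *: v.

End Representations.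

(* The weight lattice of SL(n+1), a free group on the fundamental weights,
   is identified with Z^n: the row [a] stands for
   a 0 0 * omega_1 + ... + a 0 (n-1) * omega_n.
   The weight lattice of SL(n+1) x SL(n+1) is then the product of two copies. *)
Notation SLweight n := 'rV[int]_n (only parsing).
Notation Gweight n := ('rV[int]_n * 'rV[int]_n)%type (only parsing).

(* omega n 0 = omega n n.+1 = 0. *)
Definition omega (n i : nat) : SLweight n := \row_(j < n) ((j.+1 == i)%N%:R).

Definition dominant (n : nat) (a : SLweight n) : Prop := forall j, 0 <= a 0 j.

Definition Gdominant (n : nat) (l : Gweight n) : Prop :=
  dominant l.1 /\ dominant l.2.

Section SLGroups.
Variables (C : fieldType) (n : nat).

Local Notation H := (SL C n.+1).
Local Notation G := (H * H)%type.

Definition Hcoord (g : H) : 'I_(n.+1 * n.+1) -> C := mxvec g 0.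

Definition Gcoord (g : G) : 'I_(n.+1 * n.+1 + n.+1 * n.+1) -> C :=
  row_mx (mxvec g.1) (mxvec g.2) 0.

Definition Hborel : set H :=
  [set b | forall i j : 'I_n.+1, (j < i)%N -> b i j = 0].

Definition Gborel : set G := [set b | Hborel b.1 /\ Hborel b.2].

(* omega_(j+1) maps b to b_11 * ... * b_(j+1)(j+1). *)
Definition Hchar (a : SLweight n) (b : H) : C :=
  \prod_(j < n) (\prod_(i < n.+1 | (i <= j)%N) b i i) ^ (a 0 j).

Definition Gchar (l : Gweight n) (b : G) : C :=
  Hchar l.1 b.1 * Hchar l.2 b.2.

(* These determine (V, rho) up to isomorphism: V is pi^H_a, resp. pi^G_l. *)
Definition is_piH (a : SLweight n) (V : vectType C) (rho : H -> 'End(V)) :=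
  irreducible_rep Hcoord rho /\ has_highest_weight Hborel (Hchar a) rho.

Definition is_piG (l : Gweight n) (V : vectType C) (rho : G -> 'End(V)) :=
  irreducible_rep Gcoord rho /\ has_highest_weight Gborel (Gchar l) rho.

Definition diag (h : H) : G := (h, h).

Definition contains_piH (V : vectType C) (rho : G -> 'End(V))
    (mu : SLweight n) : Prop :=
  exists (W : vectType C) (sigma : H -> 'End(W)),
    is_piH mu sigma /\
    exists2 f : 'Hom(W, V), lker f = 0%VS
      & forall h w, f (sigma h w) = rho (diag h) (f w).

Definition PplusG (mu : SLweight n) : set (Gweight n) :=
  [set l | Gdominant l /\
     exists (V : vectType C) (rho : G -> 'End(V)),
       is_piG l rho /\ contains_piH rho mu].

End SLGroups.

Definition Bset (n k : nat) : set (Gweight n) :=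
  [set b | exists2 k_ : nat -> nat, (\sum_(1 <= i < n.+2) k_ i)%N = k
     & b = \sum_(1 <= i < n.+2)
             ((omega n i, omega n (n.+2 - i)) : Gweight n) *+ k_ i].

Arguments PplusG C {n} mu.
Arguments Bset n k : clear implicits.

(* Main.v *)
(** A pair (l, mu) is detected by a nonzero regular function F on G with
    F (b g) = chi_l(b) F g for b in the opposite Borel subgroup and
    F (g (h, h)) = chi_mu(h) F g for h in B ("spherical" below).  If
    V = pi_l contains pi_mu, take F g = phi (g v), with phi a functional
    equivariant under the opposite Borel subgroup and v the highest weight vector
    of pi_mu.  Conversely F is
    a matrix coefficient <v g, w> of a polynomial representation carrying a
    Hermitian form for which g^* is the adjoint of g; such representations are
    completely reducible, and orthogonal projections turn w into a highest
    weight vector of weight l and v into an H-highest weight vector of weight mu.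
    As C[G] is a domain, the pairs (l, mu) form a semigroup, and bordered
    determinants give the generators (omega_i, omega_(n+2-i)), of weight omega_1,
    and (omega_i, omega_(n+1-i)), of weight 0.
    For the converse inclusion, let mu = k omega_1.  Then x = g e_1 |->
    F (g, w0 g) is, on the open torus orbit, a monomial x^e times a constant.
    Extending over x_i = 0 gives e_i >= 0; extending F over the divisor where
    the relative position of the two flags degenerates along the j-th simple
    reflection gives e_(j+1) <= the coefficient of omega_(n+1-j) in the second
    component of l.  These inequalities are the required decomposition of l. *)
Require Import Defs.
From HB Require Import structures.
From mathcomp Require Import all_boot all_order all_algebra.
From mathcomp Require Import mpoly complex.
From mathcomp Require Import boolp classical_sets reals.
From mathcomp Require Import perm mxtens spectral sesquilinear.
From mathcomp Require Import zify ring.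

Set Implicit Arguments.
Unset Strict Implicit.
Unset Printing Implicit Defensive.

Import Order.TTheory GRing.Theory Num.Theory.
Local Open Scope ring_scope.

(** * Regular functions *)

(** What makes the weight [k omega_1] tractable: covariance under right multiplication by upper h
    with factor h_11^k forces invariance under the lower root subgroups that fix e_1, so such a
    function of g depends on g e_1 only and is homogeneous of degree k in it. A pair (x, y) in
    general position satisfies y x^-1 = u l with u upper and l lower; covariance then moves it to
    the diagonal pair (l x, l x), where the torus is the covariance left over on the left. The torus
    has an open orbit on the lines of C^(n+1), hence the single monomial. Its elements have
    determinant 1 and scale one coordinate against the others by (n+1)-th powers, which is why
    exponents first appear multiplied by n + 1. In the resulting decomposition the exponents are the
    coefficients on the generators of B(k omega_1), and the slacks of the inequalities are those on
    the generators of weight 0. Adjacent exponents differ by the coefficients of the torus weight,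
    and this makes the first components agree. Arguments by general position all rest on one fact:
    two nonzero regular functions on G are nonzero at a common point. *)

Section FunctionAlgebras.
Variables (C : fieldType) (X : Type).

(** Three algebras are treated uniformly in this form: regular functions, functions of one variable
    with denominator a power of a fixed polynomial, and matrix coefficients of star
    representations. *)
Definition fun_subalg (K : (X -> C) -> Prop) : Prop :=
  [/\ forall c, K (fun=> c),
      forall f g, K f -> K g -> K (fun x => f x + g x)
    & forall f g, K f -> K g -> K (fun x => f x * g x)].

Variables (K : (X -> C) -> Prop) (hK : fun_subalg K).

Lemma subalg_ext f g : K f -> f =1 g -> K g.
Proof. by move=> Kf /funext <-. Qed.

Lemma subalg_const c : K (fun=> c). Proof. by case: hK. Qed.

Lemma subalg_add f g : K f -> K g -> K (fun x => f x + g x).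
Proof. by case: hK => _ h _; apply: h. Qed.

Lemma subalg_mul f g : K f -> K g -> K (fun x => f x * g x).
Proof. by case: hK => _ _ h; apply: h. Qed.

Lemma subalg_sum (I : Type) (r : seq I) (P : pred I) (F : I -> X -> C) :
  (forall i, P i -> K (F i)) -> K (fun x => \sum_(i <- r | P i) F i x).
Proof.
move=> hF; elim: r => [|i r IH].
  by apply: (subalg_ext (subalg_const 0)) => x; rewrite big_nil.
case: (boolP (P i)) => Pi; last first.
  by apply: (subalg_ext IH) => x; rewrite big_cons (negbTE Pi).
by apply: (subalg_ext (subalg_add (hF i Pi) IH)) => x; rewrite big_cons Pi.
Qed.

Lemma subalg_prod (I : Type) (r : seq I) (P : pred I) (F : I -> X -> C) :
  (forall i, P i -> K (F i)) -> K (fun x => \prod_(i <- r | P i) F i x).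
Proof.
move=> hF; elim: r => [|i r IH].
  by apply: (subalg_ext (subalg_const 1)) => x; rewrite big_nil.
case: (boolP (P i)) => Pi; last first.
  by apply: (subalg_ext IH) => x; rewrite big_cons (negbTE Pi).
by apply: (subalg_ext (subalg_mul (hF i Pi) IH)) => x; rewrite big_cons Pi.
Qed.

Lemma subalg_exp f k : K f -> K (fun x => f x ^+ k).
Proof.
move=> Kf; elim: k => [|k IH].
  by apply: (subalg_ext (subalg_const 1)) => x; rewrite expr0.
by apply: (subalg_ext (subalg_mul Kf IH)) => x; rewrite exprS.
Qed.

Lemma subalg_det m (A : X -> 'M[C]_m) :
  (forall i j, K (fun x => A x i j)) -> K (fun x => \det (A x)).
Proof.
move=> hA; rewrite /determinant; apply: subalg_sum => s _.
by apply: subalg_mul; [exact: subalg_const | apply: subalg_prod].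
Qed.

Lemma subalg_mulmx m p q (A : X -> 'M[C]_(m, p)) (B : X -> 'M[C]_(p, q)) :
  (forall i j, K (fun x => A x i j)) -> (forall i j, K (fun x => B x i j)) ->
  forall i j, K (fun x => (A x *m B x) i j).
Proof.
move=> hA hB i j.
have h : K (fun x => \sum_k A x i k * B x k j).
  by apply: subalg_sum => k _; apply: subalg_mul.
by apply: (subalg_ext h) => x; rewrite mxE.
Qed.

(** For determinant 1 the adjugate is the inverse, so this makes inversion a regular map. *)
Lemma subalg_adj m (A : X -> 'M[C]_m) :
  (forall i j, K (fun x => A x i j)) ->
  forall i j, K (fun x => \adj (A x) i j).
Proof.
move=> hA i j.
have h : K (fun x => (-1) ^+ (j + i) * \det (row' j (col' i (A x)))).
  apply: subalg_mul; first exact: subalg_const.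
  apply: subalg_det => a b.
  by apply: (subalg_ext (hA (lift j a) (lift i b))) => x; rewrite !mxE.
by apply: (subalg_ext h) => x; rewrite mxE.
Qed.

Lemma subalg_meval N (p : {mpoly C[N]}) (xi : X -> 'I_N -> C) :
  (forall i, K (fun x => xi x i)) -> K (fun x => p.@[xi x]).
Proof.
move=> hxi.
have h : K (fun x => \sum_(m <- msupp p) p@_m * \prod_i xi x i ^+ m i).
  apply: subalg_sum => m _; apply: subalg_mul; first exact: subalg_const.
  by apply: subalg_prod => i _; apply: subalg_exp.
by apply: (subalg_ext h) => x; rewrite mevalE.
Qed.

End FunctionAlgebras.

(** * Functions of one variable with prescribed denominator *)

Section RationalFunctions.
Variables (C : fieldType).

(** Off the zeros of q the function is P / q^k; at the zeros its values are left free. The case q =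
    1 gives polynomials, q = X Laurent polynomials. *)
Definition rational_fun (q : {poly C}) (f : C -> C) : Prop :=
  exists (P : {poly C}) (k : nat),
    forall s, q.[s] != 0 -> q.[s] ^+ k * f s = P.[s].

Lemma rational_fun_subalg q : fun_subalg (rational_fun q).
Proof.
split=> [c | f g [P [k hP]] [Q [l hQ]] | f g [P [k hP]] [Q [l hQ]]].
- by exists c%:P, 0%N => s _; rewrite expr0 mul1r hornerC.
- exists (q ^+ l * P + q ^+ k * Q), (k + l)%N => s qs.
  rewrite hornerD !hornerM !horner_exp -hP // -hQ // exprD; ring.
- exists (P * Q), (k + l)%N => s qs.
  rewrite hornerM -hP // -hQ // exprD; ring.
Qed.

Lemma rational_fun1 f : rational_fun 1 f ->
  exists P : {poly C}, forall s, f s = P.[s].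
Proof.
case=> P [k hP]; exists P => s; rewrite -hP ?hornerC ?oner_eq0 //.
by rewrite expr1n mul1r.
Qed.

End RationalFunctions.

Section RegularFunctions.
Variables (C : fieldType) (n : nat).
Local Notation H := (SL C n.+1).
Local Notation G := (H * H)%type.
Local Notation regG := (@regular_fun C G _ (@Gcoord C n)).
Local Notation regH := (@regular_fun C H _ (@Hcoord C n)).

Lemma regular_subalg (T : groupType) N (x : T -> 'I_N -> C) :
  fun_subalg (regular_fun x).
Proof.
split=> [c | f g [p hp] [q hq] | f g [p hp] [q hq]].
- by exists c%:MP => g; rewrite mevalC.
- by exists (p + q) => h; rewrite hp hq mevalD.
- by exists (p * q) => h; rewrite hp hq mevalM.
Qed.

Lemma regG_fst i j : regG (fun g => g.1 i j).
Proof.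
exists 'X_(lshift _ (mxvec_index i j)) => g.
by rewrite mevalXU /Gcoord row_mxEl mxvecE.
Qed.

Lemma regG_snd i j : regG (fun g => g.2 i j).
Proof.
exists 'X_(rshift _ (mxvec_index i j)) => g.
by rewrite mevalXU /Gcoord row_mxEr mxvecE.
Qed.

Lemma regH_coord i j : regH (fun g => g i j).
Proof.
by exists 'X_(mxvec_index i j) => g; rewrite mevalXU /Hcoord mxvecE.
Qed.

(** A regular function is a polynomial in the entries, so it is enough that the entries of [c] lie
    in K. With [c] a curve this restricts functions to curves; with [c] the identity it places C[G]
    inside any algebra containing the entries. *)
Lemma regG_subst (X : Type) (K : (X -> C) -> Prop) (f : G -> C) (c : X -> G) :
  fun_subalg K -> regG f ->
  (forall i j, K (fun x => (c x).1 i j)) ->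
  (forall i j, K (fun x => (c x).2 i j)) -> K (fun x => f (c x)).
Proof.
move=> hK [p hp] h1 h2.
suff h : K (fun x => p.@[Gcoord (c x)]) by apply: subalg_ext h _ => x; rewrite hp.
apply: subalg_meval => // k; rewrite -(splitK k); case: (split k) => k' /=.
  case/mxvec_indexP: k' => i j; apply: subalg_ext (h1 i j) _ => x.
  by rewrite /Gcoord row_mxEl mxvecE.
case/mxvec_indexP: k' => i j; apply: subalg_ext (h2 i j) _ => x.
by rewrite /Gcoord row_mxEr mxvecE.
Qed.

End RegularFunctions.

(** * The big cell *)

Section TriangularDecomposition.
Variable C : fieldType.

(** The product of all lower right corner minors, full determinant included: a regular function
    whose nonvanishing ensures a factorization into an upper unipotent and a lower triangular
    matrix. *)
Fixpoint trailing_minors m : 'M[C]_m -> C :=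
  match m with
  | 0 => fun=> 1
  | m'.+1 => fun A => \det A * trailing_minors (drsubmx (A : 'M_(1 + m')))
  end.

Lemma trailing_minors1 m : trailing_minors (1%:M : 'M_m) = 1.
Proof.
elim: m => [//|m IH] /=.
rewrite det1 mul1r -[RHS]IH; congr trailing_minors.
by apply/matrixP => i j; rewrite !mxE.
Qed.

Lemma subalg_trailing_minors (X : Type) (K : (X -> C) -> Prop) m
    (A : X -> 'M[C]_m) : fun_subalg K ->
  (forall i j, K (fun x => A x i j)) -> K (fun x => trailing_minors (A x)).
Proof.
move=> hK; elim: m A => [|m IH] A hA /=; first exact: subalg_const.
apply: subalg_mul => //; first exact: subalg_det.
apply: IH => i j.
by apply: subalg_ext (hA (rshift 1 i) (rshift 1 j)) _ => x; rewrite !mxE.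
Qed.

Lemma trailing_minors_det m (A : 'M[C]_m) :
  trailing_minors A != 0 -> \det A != 0.
Proof.
case: m A => [|m] A /=; first by rewrite det_mx00.
by rewrite mulf_eq0 negb_or => /andP[].
Qed.

(** Gauss elimination from the lower right corner. That block is U L by induction, with L invertible
    because the corner minor is nonzero; the border is solved by [x] and [y], and the remaining
    entry is the Schur complement. *)
Lemma UL_decomposition m (A : 'M[C]_m) : trailing_minors A != 0 ->
  exists U L : 'M[C]_m, [/\ A = U *m L, is_trig_mx L, is_trig_mx U^T
    & forall i, U i i = 1].
Proof.
elim: m A => [|m IH] A /=.
  move=> _; exists A, A; split; try by case.
  - by apply/matrixP; case.
  - by apply/is_trig_mxP; case.
  - by apply/is_trig_mxP; case.
rewrite mulf_eq0 negb_or => /andP[dA tA].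
have [U [L [eA tL tU U1]]] := IH _ tA.
have dU : \det U = 1 by rewrite -det_tr det_trig // big1 // => i _; rewrite mxE.
have uU : U \in unitmx by rewrite unitmxE dU unitr1.
have uL : L \in unitmx.
  by move: (trailing_minors_det tA); rewrite eA det_mulmx dU mul1r unitmxE unitfE.
pose A1 : 'M_(1 + m) := A.
pose x := ursubmx A1 *m invmx L.
pose y := invmx U *m dlsubmx A1.
pose V : 'M_(1 + m) := block_mx 1%:M x 0 U.
pose W : 'M_(1 + m) := block_mx (ulsubmx A1 - x *m y) 0 y L.
exists V, W; split.
- suff : A1 = V *m W by [].
  rewrite /V /W mulmx_block !mul1mx !mul0mx !add0r.
  by rewrite subrK /x /y mulmxKV // mulKVmx // -eA submxK.
- suff : is_trig_mx W by [].
  by rewrite is_trig_block_mx // eqxx tL mx11_is_trig.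
- suff : is_trig_mx V^T by [].
  by rewrite tr_block_mx is_trig_block_mx // trmx0 eqxx tU mx11_is_trig.
- move=> i; case: (@split_ordP 1 m i) => k ->.
    by apply: etrans (block_mxEul 1%:M x 0 U k k) _; rewrite !ord1 mxE.
  by apply: etrans (block_mxEdr 1%:M x 0 U k k) _.
Qed.

Lemma trig_mulmx m (A B : 'M[C]_m) :
  is_trig_mx A -> is_trig_mx B -> is_trig_mx (A *m B).
Proof.
move=> /is_trig_mxP hA /is_trig_mxP hB; apply/is_trig_mxP => i j ij.
rewrite mxE big1 // => k _; case: (ltnP i k) => ik; first by rewrite hA ?mul0r.
by rewrite hB ?mulr0 // (leq_ltn_trans ik).
Qed.

Lemma trig_mulmx_diag m (A B : 'M[C]_m) i :
  is_trig_mx A -> is_trig_mx B -> (A *m B) i i = A i i * B i i.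
Proof.
move=> /is_trig_mxP hA /is_trig_mxP hB; rewrite mxE (bigD1 i) //= big1 ?addr0 //.
move=> k ki; case: (ltnP i k) => ik; first by rewrite hA ?mul0r.
by rewrite hB ?mulr0 // ltn_neqAle ik andbT.
Qed.

(** Strong induction on the row i: in the entry (i, j) of A A^-1 = 1, terms beyond the diagonal
    vanish because A is triangular, earlier ones by induction, which leaves A_ii times the entry
    sought. *)
Lemma trig_invmx m (A : 'M[C]_m) :
  A \in unitmx -> is_trig_mx A -> is_trig_mx (invmx A).
Proof.
move=> uA tA; have /is_trig_mxP hA := tA.
have dA i : A i i != 0.
  move: uA; rewrite unitmxE det_trig // unitfE.
  by apply: contra => /eqP h; rewrite (bigD1 i) //= h mul0r.
apply/is_trig_mxP => i j; have [p] := ubnP i; elim: p i => // p IH i.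
rewrite ltnS => ip ij; have /matrixP/(_ i j) := mulmxV uA.
rewrite !mxE (bigD1 i) //= big1 => [|k ki].
  rewrite addr0 (_ : (i == j) = false); last by apply/eqP => e; rewrite e ltnn in ij.
  by move/eqP; rewrite mulf_eq0 (negbTE (dA i)) => /eqP.
case: (ltnP i k) => ik; first by rewrite hA ?mul0r.
have {}ik : (k < i)%N by rewrite ltn_neqAle ik andbT.
by rewrite (IH k) ?mulr0 ?(leq_trans ik ip) ?(ltn_trans ik ij).
Qed.

End TriangularDecomposition.

Lemma exists_nonroot (C : numFieldType) (p : {poly C}) :
  p != 0 -> exists s, p.[s] != 0.
Proof.
move=> p0; have [/hasP[x _ hx]|] := boolP (has (fun x => ~~ root p x)
    [seq k%:R | k <- iota 0 (size p)]); first by exists x.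
rewrite -all_predC => /allP h; exfalso.
have := @max_poly_roots _ p [seq k%:R | k <- iota 0 (size p)] p0.
rewrite size_map size_iota ltnn => /(_ _ _)/negP; apply => //.
  by apply/allP => x /h /=; rewrite negbK.
by rewrite map_inj_uniq ?iota_uniq // => a b /eqP; rewrite eqr_nat => /eqP.
Qed.

(** * Passing from matrices to elements of SL *)

Section SLTools.
Variables (C : fieldType) (n : nat).
Local Notation H := (SL C n.+1).

(** Matrices of determinant other than 1 go to the identity, so that curves of matrices become total
    functions into SL. *)
Definition toSL (M : 'M[C]_n.+1) : H := insubd (SL_one C n.+1) M.

Lemma toSLE M : \det M = 1 -> toSL M = M :> 'M_n.+1.
Proof. by move=> d1; apply: (insubdK (SL_one C n.+1)); apply/eqP. Qed.

Lemma SL_inj (g h : H) : g = h :> 'M_n.+1 -> g = h.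
Proof. exact: val_inj. Qed.

Lemma toSLK (g : H) : toSL g = g.
Proof. by apply: SL_inj; rewrite toSLE // det_slmx. Qed.

Lemma slmxM (g h : H) : (g * h)%g = g *m h :> 'M_n.+1.
Proof. by []. Qed.

Lemma slmxV (g : H) : (g^-1)%g = invmx g :> 'M_n.+1.
Proof. by []. Qed.

Lemma slmx1 : (1%g : H) = 1%:M :> 'M_n.+1.
Proof. by []. Qed.

Lemma slmxV_adj (g : H) : (g^-1)%g = \adj g :> 'M_n.+1.
Proof. by rewrite slmxV /invmx slmx_unit det_slmx invr1 scale1r. Qed.

Lemma toSLM M N : \det M = 1 -> \det N = 1 ->
  toSL (M *m N) = (toSL M * toSL N)%g.
Proof.
move=> dM dN; apply: SL_inj.
by rewrite slmxM !toSLE // det_mulmx dM dN mulr1.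
Qed.

Definition row0_scale (M : 'M[C]_n.+1) : 'rV[C]_n.+1 :=
  \row_i (if i == 0 then (\det M)^-1 else 1).

(** A rational retraction of GL onto SL: it brings the segment between two group elements back into
    the group. *)
Definition det_normalize (M : 'M[C]_n.+1) := diag_mx (row0_scale M) *m M.

Lemma det_row0_scale M : \det (diag_mx (row0_scale M)) = (\det M)^-1.
Proof.
rewrite det_diag big_ord_recl big1 => [|i _].
  by rewrite mxE eqxx mulr1.
by rewrite mxE.
Qed.

Lemma det_det_normalize M : \det M != 0 -> \det (det_normalize M) = 1.
Proof. by move=> d0; rewrite det_mulmx det_row0_scale mulVf. Qed.

Lemma det_normalizeE M i j :
  det_normalize M i j = (if i == 0 then (\det M)^-1 else 1) * M i j.
Proof. by rewrite /det_normalize mul_diag_mx !mxE. Qed.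

End SLTools.

(** * General position and density of the big cell *)

Section Density.
Variables (C : numFieldType) (n : nat).
Local Notation H := (SL C n.+1).
Local Notation G := (H * H)%type.
Local Notation regG := (@regular_fun C G _ (@Gcoord C n)).

Definition seg_poly (g h : 'M[C]_n.+1) : 'M[{poly C}]_n.+1 :=
  \matrix_(i, j) ((1 - 'X) * (g i j)%:P + 'X * (h i j)%:P).

Definition seg (g h : 'M[C]_n.+1) (s : C) := (1 - s) *: g + s *: h.

Lemma seg_polyE g h s : map_mx (horner_eval s) (seg_poly g h) = seg g h s.
Proof.
by apply/matrixP => i j; rewrite !mxE /horner_eval !hornerE.
Qed.

Lemma det_seg_poly g h s : (\det (seg_poly g h)).[s] = \det (seg g h s).
Proof.
by rewrite -seg_polyE det_map_mx.
Qed.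

Lemma seg0 g h : seg g h 0 = g.
Proof. by rewrite /seg subr0 scale1r scale0r addr0. Qed.

Lemma seg1 g h : seg g h 1 = h.
Proof. by rewrite /seg subrr scale1r scale0r add0r. Qed.

Lemma rational_seg (g h : 'M[C]_n.+1) (q : {poly C}) i j :
  rational_fun (\det (seg_poly g h) * q)
    (fun s => toSL (det_normalize (seg g h s)) i j).
Proof.
exists ((if i == 0 then 1 else \det (seg_poly g h)) * seg_poly g h i j * q), 1%N => s.
rewrite !hornerM det_seg_poly mulf_eq0 negb_or => /andP[ds qs].
rewrite toSLE ?det_det_normalize // det_normalizeE.
have -> : seg g h s i j = (seg_poly g h i j).[s] by rewrite -seg_polyE mxE.
by case: eqP => _; rewrite expr1 ?hornerC ?det_seg_poly; field.
Qed.

(* The two points lie on a rational curve, on which f1 and f2 restrict to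
   rational functions of one variable. *)
Lemma regG_mul_neq0 (f1 f2 : G -> C) g h : regG f1 -> regG f2 ->
  f1 g != 0 -> f2 h != 0 -> exists k, f1 k != 0 /\ f2 k != 0.
Proof.
move=> r1 r2 n1 n2.
pose q1 := \det (seg_poly g.1 h.1); pose q2 := \det (seg_poly g.2 h.2).
pose q := q1 * q2.
pose c s : G := (toSL (det_normalize (seg g.1 h.1 s)),
                 toSL (det_normalize (seg g.2 h.2 s))).
have hc1 i j : rational_fun q (fun s => (c s).1 i j) by apply: rational_seg.
have hc2 i j : rational_fun q (fun s => (c s).2 i j).
  by rewrite /q mulrC; apply: rational_seg.
have hrat f : regG f -> rational_fun q (fun s => f (c s)).
  by move=> rf; apply: (@regG_subst C n C) => //; apply: rational_fun_subalg.
have [P1 [k1 e1]] := hrat _ r1; have [P2 [k2 e2]] := hrat _ r2.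
have nrm1 (x : H) : det_normalize x = x.
  apply/matrixP => i j; rewrite det_normalizeE det_slmx invr1.
  by case: ifP; rewrite mul1r.
have c0 : c 0 = g by rewrite /c !seg0 !nrm1 !toSLK; case: (g).
have c1 : c 1 = h by rewrite /c !seg1 !nrm1 !toSLK; case: (h).
have q0 : q.[0] != 0 by rewrite hornerM !det_seg_poly !seg0 !det_slmx mulr1 oner_neq0.
have q1' : q.[1] != 0 by rewrite hornerM !det_seg_poly !seg1 !det_slmx mulr1 oner_neq0.
have nz (p : {poly C}) s : p.[s] != 0 -> p != 0.
  by apply: contraNneq => ->; rewrite horner0.
have P10 : P1 != 0 by apply: (@nz _ 0); rewrite -e1 // c0 mulf_neq0 ?expf_neq0.
have P20 : P2 != 0 by apply: (@nz _ 1); rewrite -e2 // c1 mulf_neq0 ?expf_neq0.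
have [s] := @exists_nonroot C (P1 * P2 * q) (mulf_neq0 (mulf_neq0 P10 P20) (nz _ _ q0)).
rewrite hornerM mulf_eq0 negb_or => /andP[+ qs].
rewrite hornerM mulf_eq0 negb_or => /andP[h1 h2].
exists (c s); split.
  by move: h1; rewrite -e1 // mulf_eq0 negb_or => /andP[].
by move: h2; rewrite -e2 // mulf_eq0 negb_or => /andP[].
Qed.

Definition lower (b : H) := is_trig_mx b.
Definition upper (b : H) := is_trig_mx b^T.
Definition unip (u : H) := forall i, u i i = 1.

Lemma SL_UL (g : H) : trailing_minors g != 0 ->
  exists u l : H, [/\ g = (u * l)%g, upper u, unip u & lower l].
Proof.
move=> /UL_decomposition[U [L [eg tL tU U1]]].
have dU : \det U = 1 by rewrite -det_tr det_trig // big1 // => i _; rewrite mxE.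
have dL : \det L = 1.
  by have := det_slmx g; rewrite eg det_mulmx dU mul1r.
exists (toSL U), (toSL L); split; rewrite /upper /unip /lower ?toSLE //.
by apply: SL_inj; rewrite slmxM !toSLE.
Qed.

Lemma lowerM b c : lower b -> lower c -> lower (b * c)%g.
Proof. exact: trig_mulmx. Qed.

Lemma lowerV b : lower b -> lower b^-1%g.
Proof. by apply: trig_invmx; apply: slmx_unit. Qed.

Lemma lowerM_diag (b c : H) i :
  lower b -> lower c -> (b * c)%g i i = b i i * c i i.
Proof. exact: trig_mulmx_diag. Qed.

Lemma upperM b c : upper b -> upper c -> upper (b * c)%g.
Proof. by rewrite /upper slmxM trmx_mul => hb hc; apply: trig_mulmx. Qed.

Lemma upperV b : upper b -> upper b^-1%g.
Proof.
rewrite /upper slmxV trmx_inv; apply: trig_invmx.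
by rewrite unitmx_tr slmx_unit.
Qed.

Lemma upperM_diag (b c : H) i :
  upper b -> upper c -> (b * c)%g i i = b i i * c i i.
Proof.
move=> hb hc; have := @trig_mulmx_diag _ _ (slmx c)^T (slmx b)^T i hc hb.
by rewrite -trmx_mul !mxE mulrC.
Qed.

Lemma unipV b : upper b -> unip b -> unip b^-1%g.
Proof.
move=> hb b1 i; have := upperM_diag i hb (upperV hb).
by rewrite mulgV slmx1 mxE eqxx b1 mul1r.
Qed.

Definition Glower (b : G) := lower b.1 /\ lower b.2.
Definition Gunip (u : G) := (upper u.1 /\ unip u.1) /\ (upper u.2 /\ unip u.2).

Lemma regG_dense (f : G -> C) : regG f ->
  (forall b u, Glower b -> Gunip u -> f (b * u)%g = 0) -> forall g, f g = 0.
Proof.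
move=> rf hf g; apply/eqP; apply/negPn/negP => fg.
(* Inverses are taken because the factorization yields upper times lower, while the cell consists of
   products lower times upper. *)
pose f2 (h : G) := trailing_minors (h.1^-1)%g * trailing_minors (h.2^-1)%g.
have rf2 : regG f2.
  have hs := regular_subalg (@Gcoord C n); apply: subalg_mul => //.
    apply: subalg_trailing_minors => // i j.
    apply: subalg_ext (subalg_adj hs (@regG_fst C n) i j) _ => x.
    by rewrite -slmxV_adj.
  apply: subalg_trailing_minors => // i j.
  apply: subalg_ext (subalg_adj hs (@regG_snd C n) i j) _ => x.
  by rewrite -slmxV_adj.
have f21 : f2 1%g != 0.
  by rewrite /f2 invg1 slmx1 trailing_minors1 mulr1 oner_neq0.
have [k [fk]] := regG_mul_neq0 rf rf2 fg f21.
rewrite mulf_eq0 negb_or => /andP[/SL_UL[u1 [l1 [e1 u1u u1n l1l]]]].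
move=> /SL_UL[u2 [l2 [e2 u2u u2n l2l]]].
move: fk; have -> : k = ((l1^-1, l2^-1) * (u1^-1, u2^-1))%g.
  have -> : k = ((k.1^-1)^-1, (k.2^-1)^-1)%g by rewrite !invgK; case: (k).
  by rewrite e1 e2 !invgM.
rewrite hf ?eqxx //; first by split; apply: lowerV.
by split; split; try apply: upperV => //; apply: unipV.
Qed.

End Density.

(** * Vectors fixed by unipotent subgroups *)

Section PolynomialMatrices.
Variable C : numFieldType.

Lemma poly_eq_ext (p q : {poly C}) :
  (forall s, s != 0 -> p.[s] = q.[s]) -> p = q.
Proof.
move=> h; apply/eqP; rewrite -subr_eq0; apply/negPn/negP => d0.
have [s] := exists_nonroot (mulf_neq0 (negbT (polyX_eq0 C)) d0).
rewrite hornerM hornerX mulf_eq0 negb_or => /andP[s0].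
by rewrite hornerD hornerN h // subrr eqxx.
Qed.

Definition evmx m k (s : C) (Q : 'M[{poly C}]_(m, k)) : 'M[C]_(m, k) :=
  map_mx (horner_eval s) Q.

Definition coefmx m k (d : nat) (Q : 'M[{poly C}]_(m, k)) : 'M[C]_(m, k) :=
  \matrix_(i, j) (Q i j)`_d.

Definition polyCmx m k (A : 'M[C]_(m, k)) : 'M[{poly C}]_(m, k) :=
  map_mx (@polyC C) A.

Lemma evmxM m k l s (P : 'M_(m, k)) (Q : 'M_(k, l)) :
  evmx s (P *m Q) = evmx s P *m evmx s Q.
Proof. exact: map_mxM. Qed.

Lemma evmxC m k s (A : 'M[C]_(m, k)) : evmx s (polyCmx A) = A.
Proof. by apply/matrixP => i j; rewrite !mxE /horner_eval hornerC. Qed.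

Lemma evmxZ m k s p (Q : 'M_(m, k)) : evmx s (p *: Q) = p.[s] *: evmx s Q.
Proof. by apply/matrixP => i j; rewrite !mxE /horner_eval hornerM. Qed.

Lemma coefmxCM m k l d (A : 'M[C]_(m, k)) (Q : 'M_(k, l)) :
  coefmx d (polyCmx A *m Q) = A *m coefmx d Q.
Proof.
apply/matrixP => i j; rewrite !mxE coef_sum; apply: eq_bigr => a _.
by rewrite !mxE coefCM.
Qed.

Lemma coefmxMC m k l d (Q : 'M_(m, k)) (A : 'M[C]_(k, l)) :
  coefmx d (Q *m polyCmx A) = coefmx d Q *m A.
Proof.
apply/matrixP => i j; rewrite !mxE coef_sum; apply: eq_bigr => a _.
by rewrite !mxE coefMC.
Qed.

Lemma evmx_inj m k (P Q : 'M_(m, k)) :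
  (forall s, s != 0 -> evmx s P = evmx s Q) -> P = Q.
Proof.
move=> h; apply/matrixP => i j; apply: poly_eq_ext => s s0.
by have /matrixP/(_ i j) := h s s0; rewrite !mxE.
Qed.

Lemma evmx_sum_coef m k (Q : 'M_(m, k)) : exists L,
  (forall d, (L <= d)%N -> coefmx d Q = 0) /\
  forall s, evmx s Q = \sum_(d < L) s ^+ d *: coefmx d Q.
Proof.
pose L := (\sum_i \sum_j size (Q i j))%N.
have hL i j : (size (Q i j) <= L)%N.
  rewrite /L (bigD1 i) //= (bigD1 j) //= -addnA; exact: leq_addr.
exists L; split=> [d Ld | s]; apply/matrixP => i j; rewrite ?mxE.
  by rewrite nth_default // (leq_trans (hL i j)).
rewrite /horner_eval (horner_coef_wide s (hL i j)) summxE.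
by apply: eq_bigr => d _; rewrite !mxE mulrC.
Qed.

Lemma evmx0 m k (Q : 'M_(m, k)) : evmx 0 Q = coefmx 0 Q.
Proof. by apply/matrixP => i j; rewrite !mxE /horner_eval horner_coef0. Qed.

Lemma rational_mx m k (q : {poly C}) (A : C -> 'M[C]_(m, k)) :
  (forall i j, rational_fun q (fun s => A s i j)) ->
  exists (Q : 'M_(m, k)) (K : nat),
    forall s, q.[s] != 0 -> q.[s] ^+ K *: A s = evmx s Q.
Proof.
move=> h.
have /fin_all_exists[P hP] (ij : 'I_m * 'I_k) : exists Pk : {poly C} * nat,
    forall s, q.[s] != 0 -> q.[s] ^+ Pk.2 * A s ij.1 ij.2 = Pk.1.[s].
  by have [P [K hP]] := h ij.1 ij.2; exists (P, K).
pose K := (\sum_ij (P ij).2)%N.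
have hK ij : ((P ij).2 <= K)%N by rewrite /K (bigD1 ij) //= leq_addr.
exists (\matrix_(i, j) (q ^+ (K - (P (i, j)).2) * (P (i, j)).1)), K => s qs.
apply/matrixP => i j; rewrite !mxE /horner_eval hornerM horner_exp.
by rewrite -(hP (i, j)) // mulrA -exprD subnK.
Qed.

End PolynomialMatrices.

Section LieKolchin.
Variables (C : numFieldType) (n : nat).
Local Notation H := (SL C n.+1).
Local Notation G := (H * H)%type.
Local Notation regG := (@regular_fun C G _ (@Gcoord C n)).

Definition Gluni (u : G) :=
  (lower u.1 /\ unip u.1) /\ (lower u.2 /\ unip u.2).

(** The cocharacter 2 rho^vee, with entries s^(n - 2i), written as a quotient of natural powers; the
    exponents sum to 0, so the determinant is 1. *)
Definition onepar (s : C) : 'M[C]_n.+1 :=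
  diag_mx (\row_i (s ^+ (2 * (n - i)) / s ^+ n)).

Lemma sum_onepar : (\sum_(i < n.+1) 2 * (n - i) = n * n.+1)%N.
Proof.
rewrite -big_distrr /= mul2n -addnn.
rewrite [X in (X + _)%N](reindex_inj rev_ord_inj) /= -big_split /=.
rewrite (eq_bigr (fun=> n)) ?sum_nat_const ?card_ord 1?mulnC // => i _.
by have := ltn_ord i; lia.
Qed.

Lemma det_onepar s : s != 0 -> \det (onepar s) = 1.
Proof.
move=> s0; rewrite det_diag.
under eq_bigr do rewrite mxE.
rewrite big_split /= prodr_const card_ord -expr_sum sum_onepar.
by rewrite -exprVn -exprM -exprMn mulfV ?expr1n.
Qed.

Lemma oneparE s i j : onepar s i j = (i == j)%:R * (s ^+ (2 * (n - i)) / s ^+ n).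
Proof. by rewrite !mxE; case: eqP => [->|_]; rewrite ?mul1r ?mul0r ?mulr1n ?mulr0n. Qed.

Lemma rational_onepar i j : rational_fun 'X (fun s => toSL (onepar s) i j).
Proof.
exists ((i == j)%:R%:P * 'X^(2 * (n - i))), n => s; rewrite hornerX => s0.
rewrite toSLE ?det_onepar // oneparE hornerM hornerC hornerXn.
have sn0 : s ^+ n != 0 by rewrite expf_neq0.
by field.
Qed.

(** The conjugate of u by [onepar r], in a form that extends to r = 0. The truncated subtraction is
    harmless since u is lower triangular. *)
Definition contract (u : 'M[C]_n.+1) (r : C) : 'M[C]_n.+1 :=
  \matrix_(i, j) (u i j * r ^+ (2 * (i - j))).

Lemma contractE (u : H) r : lower u -> r != 0 ->
  onepar r *m contract u r = u *m onepar r.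
Proof.
move=> /is_trig_mxP lu r0; apply/matrixP => i j.
rewrite mul_diag_mx mul_mx_diag !mxE.
case: (ltnP i j) => ij; first by rewrite lu // !mul0r mulr0.
have -> : (2 * (n - j) = 2 * (n - i) + 2 * (i - j))%N.
  by have := ltn_ord i; lia.
rewrite exprD; ring.
Qed.

Lemma det_contract (u : H) r : lower u -> unip u -> \det (contract u r) = 1.
Proof.
move=> /is_trig_mxP lu u1; rewrite det_trig.
  by rewrite big1 // => i _; rewrite mxE u1 subnn muln0 expr0 mulr1.
by apply/is_trig_mxP => i j ij; rewrite mxE lu ?mul0r.
Qed.

Lemma contract0 (u : H) : lower u -> unip u -> contract u 0 = 1%:M.
Proof.
move=> /is_trig_mxP lu u1; apply/matrixP => i j; rewrite !mxE.
case: (ltngtP i j) => ij.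
- by rewrite lu // mul0r -val_eqE /= ltn_eqF.
- have -> : (i == j) = false by rewrite -val_eqE /= gtn_eqF.
  by rewrite expr0n muln_eq0 subn_eq0 leqNgt ij mulr0.
- by rewrite (val_inj ij) u1 subnn muln0 expr0 mulr1 eqxx.
Qed.

Lemma rational_contract (u : H) i j : lower u -> unip u ->
  rational_fun 1 (fun r => toSL (contract u r) i j).
Proof.
move=> lu u1; exists ((u i j)%:P * 'X^(2 * (i - j))), 0%N => s _.
by rewrite toSLE ?det_contract // mxE hornerM !hornerC hornerXn expr0 mul1r.
Qed.

Lemma contract_toSL (u : H) r : lower u -> unip u -> r != 0 ->
  (toSL (onepar r) * toSL (contract u r) = u * toSL (onepar r))%g.
Proof.
move=> lu u1 r0; apply: SL_inj; rewrite !slmxM !toSLE ?det_onepar ?det_contract //.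
by apply: contractE.
Qed.

(* [v] is taken in the extremal weight space of the one-parameter group
   [onepar]: conjugation by that group contracts lower unipotents to 1. *)
Lemma exists_unip_fixed N (M : G -> 'M[C]_N) (S : 'M[C]_N) :
  (forall i j, regG (fun g => M g i j)) ->
  (forall g h, M (g * h)%g = M g *m M h) -> M 1%g = 1%:M ->
  S != 0 -> (forall g, (S *m M g <= S)%MS) ->
  exists v : 'rV_N, [/\ v != 0, (v <= S)%MS & forall u, Gluni u -> v *m M u = v].
Proof.
move=> rM MM M1 S0 hS.
pose lam s : G := (toSL (onepar s), toSL (onepar s)).
have [P [K hP]] : exists (P : 'M_N) (K : nat),
    forall s, ('X : {poly C}).[s] != 0 -> 'X.[s] ^+ K *: M (lam s) = evmx s P.
  apply: rational_mx => i j.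
  apply: (@regG_subst C n C _ _ lam (rational_fun_subalg 'X) (rM i j)) => a b;
    exact: rational_onepar.
have {}hP s : s != 0 -> s ^+ K *: M (lam s) = evmx s P.
  by move=> s0; have := hP s; rewrite hornerX => ->.
have P1 : evmx 1 P = 1%:M.
  rewrite -hP ?oner_neq0 // expr1n scale1r -M1; congr M.
  have e : onepar 1 = 1%:M.
    apply/matrixP => i j; rewrite oneparE !expr1n divr1 mulr1 mxE.
    by [].
  by rewrite /lam e; congr pair; apply: SL_inj; rewrite toSLE ?det1.
have lamM s r : s != 0 -> r != 0 -> lam (s * r) = (lam s * lam r)%g.
  move=> s0 r0; have e : toSL (onepar (s * r)) = (toSL (onepar s) * toSL (onepar r))%g.
    apply: SL_inj; rewrite slmxM !toSLE ?det_onepar ?mulf_neq0 //.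
    apply/matrixP => i j; rewrite mul_diag_mx !oneparE !mxE.
    have sn0 : s ^+ n != 0 by rewrite expf_neq0.
    have rn0 : r ^+ n != 0 by rewrite expf_neq0.
    case: (eqVneq i j) => _; rewrite ?mulr1n ?mulr0n ?mulr0 ?mul0r // mul1r.
    by rewrite !exprMn; field; rewrite sn0 rn0.
  by rewrite /lam e.
(* The coefficients of P are the projections to the weight spaces of the one-parameter group,
   weights being shifted by K. *)
have Pmul d r : r != 0 -> coefmx d P *m evmx r P = r ^+ d *: coefmx d P.
  move=> r0; rewrite -coefmxMC.
  pose Q : 'M[{poly C}]_N := \matrix_(i, j) \poly_(k < size (P i j)) ((P i j)`_k * r ^+ k).
  have -> : P *m polyCmx (evmx r P) = Q.
    apply: evmx_inj => s s0; rewrite evmxM evmxC.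
    have -> : evmx s Q = evmx (s * r) P.
      apply/matrixP => i j; rewrite !mxE /horner_eval horner_poly horner_coef.
      by apply: eq_bigr => k _; rewrite exprMn; ring.
    rewrite -!hP ?mulf_neq0 // lamM // MM -scalemxAl -scalemxAr scalerA.
    by rewrite exprMn.
  apply/matrixP => i j; rewrite !mxE coef_poly.
  by case: ltnP => h; [ring | rewrite nth_default ?mulr0].
(* Lying in the row space of S is the vanishing of the product with the cokernel, a condition that
   passes from the values of P to its coefficients. *)
have SP d : (S *m coefmx d P <= S)%MS.
  rewrite submxE -coefmxCM -coefmxMC.
  have -> : polyCmx S *m P *m polyCmx (cokermx S) = 0.
    apply: evmx_inj => s s0; rewrite !evmxM !evmxC -hP //.
    have /submxP[D hD] := hS (lam s).
    rewrite -scalemxAr -scalemxAl hD -mulmxA mulmx_coker mulmx0 scaler0.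
    by apply/matrixP => i j; rewrite !mxE /horner_eval horner0.
  by apply/eqP/matrixP => i j; rewrite !mxE coef0.
have [L [hL eL]] := evmx_sum_coef P.
have ex : exists d, S *m coefmx d P != 0.
  apply: contrapT => h; move: S0; rewrite -[S]mulmx1 -P1 eL mulmx_sumr big1 ?eqxx //.
  move=> d _; rewrite expr1n scale1r; apply/eqP/negPn/negP => hd.
  by apply: h; exists d.
have bd d : S *m coefmx d P != 0 -> (d <= L)%N.
  by move=> hd; rewrite leqNgt; apply/negP => /ltnW/hL e; rewrite e mulmx0 eqxx in hd.
(* D is the largest shifted weight occurring in S. *)
case: (ex_maxnP ex bd) => D hD maxD.
have [i vi0] : exists i, row i (S *m coefmx D P) != 0.
  apply: contrapT => h; move: hD; apply/negP/negPn/eqP/row_matrixP => i.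
  rewrite row0; apply/eqP/negPn/negP => hi; apply: h; by exists i.
exists (row i (S *m coefmx D P)); split=> //.
  exact: submx_trans (row_sub _ _) (SP D).
set v := row i _ in vi0 *.
have vP r : r != 0 -> v *m evmx r P = r ^+ D *: v.
  by move=> r0; rewrite /v row_mul -mulmxA Pmul // -scalemxAr.
have vS : (v <= S)%MS by exact: submx_trans (row_sub _ _) (SP D).
move=> u [[l1 u1] [l2 u2]].
pose cu r : G := (toSL (contract u.1 r), toSL (contract u.2 r)).
have [Q hQ] : exists Q : 'M_N, forall r, M (cu r) = evmx r Q.
  have [Q [k hQ]] : exists (Q : 'M_N) (K : nat), forall s,
      (1 : {poly C}).[s] != 0 -> 1.[s] ^+ K *: M (cu s) = evmx s Q.
    apply: rational_mx => a b.
    by apply: (@regG_subst C n C _ _ cu (rational_fun_subalg 1) (rM a b)) => a' b';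
      apply: rational_contract.
  by exists Q => r; rewrite -hQ ?hornerC ?oner_eq0 // expr1n scale1r.
have cu0 : cu 0 = 1%g.
  rewrite /cu !contract0 //.
  by congr pair; apply: SL_inj; rewrite toSLE ?det1.
set w := v *m M u.
have wS : (w <= S)%MS by apply: submx_trans (hS u); apply: submxMr.
(* This comes from u [lam r] = [lam r] [cu r]. Divisibility by X^D kills the components of w of
   weight below D; the component of weight D is v since [cu 0] = 1; those above D vanish by
   maximality. The components sum to w because P takes the value 1 at 1. *)
have id : polyCmx w *m P = 'X^D *: (polyCmx v *m Q).
  apply: evmx_inj => r r0; rewrite evmxZ hornerXn !evmxM !evmxC.
  rewrite -hQ scalemxAl -vP // -!hP // -!scalemxAr -scalemxAl; congr (_ *: _).
  rewrite /w -!mulmxA -!MM; congr (_ *m M _).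
  by apply: injective_projections; apply: esym; apply: contract_toSL.
have cw d : w *m coefmx d P = if d == D then v else 0.
  have -> : w *m coefmx d P = coefmx d ('X^D *: (polyCmx v *m Q)).
    by rewrite -id coefmxCM.
  have [->|dD] := eqVneq d D.
    have -> : coefmx D ('X^D *: (polyCmx v *m Q)) = coefmx 0 (polyCmx v *m Q).
      by apply/matrixP => a b; rewrite !mxE coefXnM ltnn subnn.
    by rewrite coefmxCM -evmx0 -hQ cu0 M1 mulmx1.
  case: (ltnP d D) => dD'.
    by apply/matrixP => a b; rewrite !mxE coefXnM dD'.
  rewrite -id coefmxCM; have /submxP[W ->] := wS.
  rewrite -mulmxA; apply/eqP/negPn/negP => h.
  have {}h : S *m coefmx d P != 0 by apply: contraNneq h => ->; rewrite mulmx0.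
  by have := maxD _ h; rewrite leqNgt ltn_neqAle dD' eq_sym dD.
rewrite -[LHS]mulmx1 -P1 eL mulmx_sumr -/w.
have DL : (D < L)%N.
  by rewrite ltnNge; apply/negP => /hL e; rewrite e mulmx0 eqxx in hD.
rewrite (bigD1 (Ordinal DL)) //= expr1n scale1r cw eqxx big1 ?addr0 // => d dD.
by rewrite expr1n scale1r cw (negbTE (_ : d != D :> nat)).
Qed.

End LieKolchin.

(** * Spherical functions *)

Section Characters.
Variables (C : numFieldType) (n : nat).
Local Notation H := (SL C n.+1).
Local Notation G := (H * H)%type.
Local Notation regG := (@regular_fun C G _ (@Gcoord C n)).

Lemma upperP (b : H) : reflect (Hborel b) (upper b).
Proof.
apply: (iffP is_trig_mxP) => h i j ij; first by have := h j i ij; rewrite mxE.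
by rewrite mxE h.
Qed.

Lemma lower_diag_neq0 (b : H) i : lower b -> b i i != 0.
Proof.
move=> lb; have := det_slmx b; rewrite det_trig // => e.
by apply/eqP => h; have := oner_neq0 C; rewrite -e (bigD1 i) //= h mul0r eqxx.
Qed.

Lemma upper_diag_neq0 (b : H) i : upper b -> b i i != 0.
Proof.
move=> lb; have := det_slmx b; rewrite -det_tr det_trig // => e.
have := oner_neq0 C; rewrite -e (bigD1 i) //= mxE mulf_eq0 negb_or.
by case/andP.
Qed.

Lemma HcharM (a : SLweight n) (b c : H) :
  (forall i, (b * c)%g i i = b i i * c i i) ->
  Hchar a (b * c)%g = Hchar a b * Hchar a c.
Proof.
move=> h; rewrite /Hchar -big_split /=; apply: eq_bigr => j _.
by rewrite -expfzMl -big_split /=; congr (_ ^ _); apply: eq_bigr => i _.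
Qed.

Lemma Hchar_unip (a : SLweight n) (b : H) : unip b -> Hchar a b = 1.
Proof. by move=> b1; rewrite /Hchar big1 // => j _; rewrite big1 ?exp1rz. Qed.

Lemma HcharD (a a' : SLweight n) (b : H) : (forall i, b i i != 0) ->
  Hchar (a + a') b = Hchar a b * Hchar a' b.
Proof.
move=> b0; rewrite /Hchar -big_split /=; apply: eq_bigr => j _.
by rewrite mxE expfzDr //; apply/prodf_neq0 => i _.
Qed.

Lemma Hchar0 (b : H) : Hchar 0 b = 1.
Proof. by rewrite /Hchar big1 // => j _; rewrite mxE expr0z. Qed.

Lemma GcharM (l : Gweight n) (b c : G) : Glower b -> Glower c ->
  Gchar l (b * c)%g = Gchar l b * Gchar l c.
Proof.
move=> [b1 b2] [c1 c2]; rewrite /Gchar mulrACA !HcharM // => i;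
  exact: lowerM_diag.
Qed.

(* Such functions stand for the pairs formed by an irreducible G-module of
   highest weight [l] and a highest weight vector of weight [mu] for H in it. *)
Definition spherical (l : Gweight n) (mu : SLweight n) (F : G -> C) : Prop :=
  [/\ regG F, exists g, F g != 0,
      forall b g, Glower b -> F (b * g)%g = Gchar l b * F g
    & forall b g, upper b -> F (g * diag b)%g = Hchar mu b * F g].

Lemma sphericalM l l' mu mu' F F' : spherical l mu F -> spherical l' mu' F' ->
  spherical (l + l') (mu + mu') (fun g => F g * F' g).
Proof.
move=> [r [g Fg] L R] [r' [g' Fg'] L' R']; split.
- by apply: subalg_mul => //; apply: regular_subalg.
- have [k [h1 h2]] := regG_mul_neq0 r r' Fg Fg'; exists k.
  by rewrite mulf_neq0.
- move=> b k [lb1 lb2]; rewrite L // L' // /Gchar !HcharD; first by ring.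
  + by move=> i; apply: lower_diag_neq0.
  + by move=> i; apply: lower_diag_neq0.
- move=> b k ub; rewrite R // R' // HcharD; first by ring.
  by move=> i; apply: upper_diag_neq0.
Qed.

Definition diag_part (b : H) : H := toSL (diag_mx (\row_i b i i)).

Lemma diag_partE (b : H) : lower b ->
  diag_part b = diag_mx (\row_i b i i) :> 'M_n.+1.
Proof.
move=> lb; rewrite toSLE // det_diag -[RHS](det_slmx b) det_trig //.
by apply: eq_bigr => i _; rewrite mxE.
Qed.

(** The factor t is diagonal, so the character of the upper Borel subgroup can be evaluated on
    it. *)
Lemma lower_decomp (b : H) : lower b -> exists u t : H,
  [/\ b = (u * t)%g, lower u, unip u, upper t & forall i, t i i = b i i].
Proof.
move=> lb; pose t := diag_part b.
have lt : lower t by rewrite /lower diag_partE // diag_mx_is_trig.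
exists (b * t^-1)%g, t; split.
- by rewrite mulgVK.
- by apply: lowerM => //; apply: lowerV.
- move=> i; rewrite lowerM_diag //; last exact: lowerV.
  have e : b i i = t i i by rewrite diag_partE // !mxE eqxx.
  by rewrite e -lowerM_diag ?mulgV ?slmx1 ?mxE ?eqxx //; apply: lowerV.
- by rewrite /upper diag_partE // tr_diag_mx diag_mx_is_trig.
- by move=> i; rewrite diag_partE // !mxE eqxx.
Qed.

End Characters.

Section InvariantSubspaces.
Variables (C : fieldType) (V : vectType C).

(** A subspace of largest dimension inside P contains every vector of P, as otherwise a line could
    be added to it. *)
Lemma exists_vspace (P : V -> Prop) : P 0 ->
  (forall a u v, P u -> P v -> P (a *: u + v)) ->
  exists U : {vspace V}, forall v, v \in U <-> P v.
Proof.
move=> P0 PD.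
pose D d := `[< exists U : {vspace V}, \dim U = d /\ forall v, v \in U -> P v >].
have ex : exists d, D d.
  exists 0%N; apply/asboolP; exists 0%VS; split; first exact: dimv0.
  by move=> v; rewrite memv0 => /eqP ->.
have bd d : D d -> (d <= dim V)%N.
  by move/asboolP => [U [<- _]]; rewrite -dimvf dimvS ?subvf.
case: (ex_maxnP ex bd) => d /asboolP[U [dU hU]] maxd.
exists U => v; split; first exact: hU.
move=> Pv.
have /maxd : D (\dim (<[v]> + U)%VS).
  apply/asboolP; exists (<[v]> + U)%VS; split=> // x /memv_addP[y /vlineP[a ->] [z zU ->]].
  by apply: PD => //; apply: hU.
rewrite -dU => le.
have /eqP e : U == (<[v]> + U)%VS by rewrite eqEdim addvSr.
by rewrite e; apply: (subvP (addvSl _ _)); exact: memv_line.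
Qed.

Lemma irreducible_alt (T : groupType) N (x : T -> 'I_N -> C) (rho : T -> 'End(V))
    (P : V -> Prop) : irreducible_rep x rho -> P 0 ->
  (forall a u v, P u -> P v -> P (a *: u + v)) ->
  (forall g v, P v -> P (rho g v)) ->
  (forall v, P v -> v = 0) \/ (forall v, P v).
Proof.
move=> [_ _ irr] P0 PD Pg; have [U hU] := exists_vspace P0 PD.
have [|e|e] := irr U.
- by move=> g; apply/subvP => _ /memv_imgP[v /hU Pv ->]; apply/hU/Pg.
- by left=> v /hU; rewrite e memv0 => /eqP.
- by right=> v; apply/hU; rewrite e memvf.
Qed.

End InvariantSubspaces.

(** * From representations to spherical functions *)

Section FromRepresentation.
Variables (C : numFieldType) (n : nat).
Local Notation H := (SL C n.+1).
Local Notation G := (H * H)%type.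
Local Notation regG := (@regular_fun C G _ (@Gcoord C n)).

(** In coordinates a functional is a row vector, and composing it with [rho g] is right
    multiplication by the matrix of [rho g]; the whole space of rows is the invariant subspace
    used. *)
Lemma exists_unip_functional (V : vectType C) (rho : G -> 'End(V)) :
  is_rep (@Gcoord C n) rho -> (fullv : {vspace V}) <> 0%VS ->
  exists phi : 'Hom(V, C^o), (exists v, phi v != 0) /\
    forall u v, Gluni u -> phi (rho u v) = phi v.
Proof.
move=> [r1 rM rreg] V0.
pose d := \dim {:V}; pose X := vbasis {:V}.
pose e (i : 'I_d) : 'Hom(V, C^o) := linfun (coord X i : V -> C^o).
have eE i v : e i v = coord X i v by rewrite lfunE.
have XE v : v = \sum_i e i v *: X`_i.
  by rewrite {1}(coord_vbasis (memvf v)); apply: eq_bigr => i _; rewrite eE.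
have freeX : free X := basis_free (vbasisP _).
pose M g : 'M[C]_d := \matrix_(i, j) e i (rho g X`_j).
have MM g h : M (g * h)%g = M g *m M h.
  apply/matrixP => i j; rewrite !mxE rM comp_lfunE {1}(XE (rho h X`_j)).
  rewrite !linear_sum; apply: eq_bigr => k _.
  by rewrite !linearZ /= !mxE mulrC.
have M1 : M 1%g = 1%:M.
  apply/matrixP => i j; rewrite !mxE r1 id_lfunE eE.
  by rewrite coord_free // eq_sym.
have S0 : (1%:M : 'M[C]_d) != 0.
  have d0 : (0 < d)%N.
    by rewrite lt0n /d dimv_eq0; apply/eqP.
  apply/eqP => /matrixP/(_ (Ordinal d0) (Ordinal d0)) /eqP.
  by rewrite !mxE eqxx oner_eq0.
have [w [w0 _ hw]] : exists v : 'rV_d, [/\ v != 0, (v <= (1%:M : 'M[C]_d))%MS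
    & forall u, Gluni u -> v *m M u = v].
  apply: exists_unip_fixed MM M1 S0 _ => [i j|g]; last exact: submx1.
  by apply: subalg_ext (rreg (e i) X`_j) _ => g; rewrite mxE.
pose phi : 'Hom(V, C^o) := \sum_i w 0 i *: e i.
have phiE v : phi v = \sum_i w 0 i * e i v.
  by rewrite sum_lfunE; apply: eq_bigr => i _; rewrite scale_lfunE.
have phiX (i : 'I_d) : phi X`_i = w 0 i.
  rewrite phiE (bigD1 i) //= eE coord_free ?freeX //.
  rewrite eqxx mulr1 big1 ?addr0 // => j ji.
  by rewrite eE coord_free ?freeX // eq_sym (negbTE ji) mulr0.
exists phi; split.
  apply: contrapT => h; move: w0; apply/negP/negPn/eqP/rowP => i; rewrite mxE.
  rewrite -phiX; apply/eqP/negPn/negP => hi; apply: h; by exists X`_i.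
move=> u v lu; rewrite (XE v) !linear_sum; apply: eq_bigr => j _.
rewrite !linearZ /=; congr (_ *: _); rewrite phiX phiE.
have /rowP/(_ j) := hw u lu; rewrite mxE => <-.
by apply: eq_bigr => i _; rewrite mxE.
Qed.

(** Unipotent invariance says nothing about the torus. At the highest weight vector, b = u t splits
    into a part absorbed by phi and a part acting by the character; density of the big cell extends
    the covariance to the orbit of that vector, and irreducibility to V, since the vectors where it
    holds form a subrepresentation. *)
Lemma highest_weight_functional (V : vectType C) (rho : G -> 'End(V)) l :
  is_piG l rho -> exists phi : 'Hom(V, C^o), (exists v, phi v != 0) /\
    forall b v, Glower b -> phi (rho b v) = Gchar l b * phi v.
Proof.
move=> [irr [v0 v00 hv0]].
have [rrep V0 _] := irr; have [r1 rM rreg] := rrep.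
have [phi [[v1 phiv1] hphi]] := exists_unip_functional rrep V0.
have rg g h v : rho (g * h)%g v = rho g (rho h v) by rewrite rM comp_lfunE.
exists phi; split; first by exists v1.
have dec b : Glower b -> phi (rho b v0) = Gchar l b * phi v0.
  case: b => b1 b2 [/= lb1 lb2].
  have [u1 [t1 [e1 lu1 u1n ut1 d1]]] := lower_decomp lb1.
  have [u2 [t2 [e2 lu2 u2n ut2 d2]]] := lower_decomp lb2.
  have -> : (b1, b2) = ((u1, u2) * (t1, t2))%g by rewrite e1 e2.
  rewrite rg hphi // hv0; last by split; apply/upperP.
  rewrite linearZ /=; congr (_ * _); rewrite /Gchar /=.
  have lt1 : lower t1.
    by rewrite -(mulKg u1 t1) -e1; apply: lowerM => //; apply: lowerV.
  have lt2 : lower t2.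
    by rewrite -(mulKg u2 t2) -e2; apply: lowerM => //; apply: lowerV.
  rewrite !HcharM ?(Hchar_unip _ u1n) ?(Hchar_unip _ u2n) ?mul1r //.
    by move=> i; apply: lowerM_diag.
  by move=> i; apply: lowerM_diag.
have cov b g : Glower b -> phi (rho (b * g)%g v0) = Gchar l b * phi (rho g v0).
  move=> lb; apply/eqP; rewrite -subr_eq0; apply/eqP; move: g.
  apply: regG_dense.
    have hs := regular_subalg (@Gcoord C n); apply: subalg_add => //.
      apply: (subalg_ext (rreg (phi \o rho b)%VF v0)) => g.
      by rewrite comp_lfunE rg.
    apply: subalg_ext (subalg_mul hs (subalg_const hs (- Gchar l b)) (rreg phi v0)) _ => g.
    by rewrite mulNr.
  move=> b' u lb' [[u1 u1n] [u2 u2n]]; rewrite mulgA !rg.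
  have -> : rho u v0 = v0.
    rewrite hv0; last by split; apply/upperP.
    by rewrite /Gchar !Hchar_unip // mulr1 scale1r.
  rewrite -rg dec; last by case: lb lb' => ? ? [? ?]; split; apply: lowerM.
  by rewrite dec // GcharM // mulrA subrr.
have [|||h|h] := irreducible_alt (P := fun v =>
    forall b g, Glower b -> phi (rho (b * g)%g v) = Gchar l b * phi (rho g v)) irr.
- by move=> b g _; rewrite !linear0 mulr0.
- move=> a u v hu hv b g lb; rewrite !linearP /= hu // hv //.
  by rewrite mulrDr; congr (_ + _); rewrite /GRing.scale /=; ring.
- by move=> h v hv b g lb; rewrite -(rg (b * g)%g h v) -(rg g h v) -mulgA (hv b).
- by exfalso; move: v00; rewrite (h v0) ?eqxx // => b g; apply: cov.
- by move=> b v lb; have := h v b 1%g lb; rewrite mulg1 r1 id_lfunE.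
Qed.

Lemma PplusG_spherical l (mu : SLweight n) :
  PplusG C mu l -> exists F : G -> C, spherical l mu F.
Proof.
move=> [_ [V [rho [pi [W [sigma [[_ [w0 w00 hw0]] [f injf hf]]]]]]]].
have [phi [[v1 phiv1] hphi]] := highest_weight_functional pi.
have [irr _] := pi; have [[r1 rM rreg] V0 _] := irr.
exists (fun g => phi (rho g (f w0))); split.
- exact: rreg.
- apply: contrapT => h.
  (* The vectors v with phi (g v) = 0 for all g form a subrepresentation that misses [v1], hence is
     0, whereas [f w0] is nonzero. *)
  have [|||h0|h0] := irreducible_alt (P := fun v => forall g, phi (rho g v) = 0) irr.
  + by move=> g; rewrite !linear0.
  + by move=> a u v hu hv g; rewrite !linearP /= hu hv scaler0 addr0.
  + by move=> g v hv g'; rewrite -(comp_lfunE (rho g')) -rM hv.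
  + have /h0/eqP : forall g, phi (rho g (f w0)) = 0.
      by move=> g; apply/eqP/negPn/negP => hg; apply: h; exists g.
    have /eqP/lker0P inj := injf.
    by rewrite -(linear0 f) (inj_eq inj) (negbTE w00).
  + by have := h0 v1 1%g; rewrite r1 id_lfunE; apply/eqP.
- by move=> b g lb; rewrite rM comp_lfunE hphi.
- move=> b g ub; rewrite rM comp_lfunE -hf hw0; last exact/upperP.
  by rewrite !linearZ.
Qed.

End FromRepresentation.

(** * From spherical functions to representations *)

Section StarRepresentations.
Variables (C : numClosedFieldType) (n : nat).
Local Notation H := (SL C n.+1).
Local Notation G := (H * H)%type.
Local Notation regG := (@regular_fun C G _ (@Gcoord C n)).
Local Open Scope sesquilinear_scope.

Lemma SL_star_subproof (g : H) : \det ((g : 'M_n.+1) ^t*) == 1.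
Proof. by rewrite det_map_mx det_tr det_slmx rmorph1. Qed.

Definition SL_star (g : H) : H := MkSL (SL_star_subproof g).

Lemma SL_tr_subproof (g : H) : \det (g : 'M_n.+1)^T == 1.
Proof. by rewrite det_tr det_slmx. Qed.

Definition SL_tr (g : H) : H := MkSL (SL_tr_subproof g).

Definition Gstar (g : G) : G := (SL_star g.1, SL_star g.2).
Definition Gtr (g : G) : G := (SL_tr g.1, SL_tr g.2).

Lemma SL_trM (g h : H) : SL_tr (g * h)%g = (SL_tr h * SL_tr g)%g.
Proof. by apply: SL_inj; rewrite /= trmx_mul. Qed.

Lemma GtrM g h : Gtr (g * h)%g = (Gtr h * Gtr g)%g.
Proof. by apply: injective_projections; apply: SL_trM. Qed.

Lemma GtrK : involutive Gtr.
Proof. by move=> g; apply: injective_projections; apply: SL_inj; rewrite /= trmxK. Qed.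

Lemma Gtr1 : Gtr 1%g = 1%g.
Proof. by apply: injective_projections; apply: SL_inj; rewrite /= trmx1. Qed.

Lemma GstarK : involutive Gstar.
Proof. by move=> g; apply: injective_projections; apply: SL_inj; rewrite /= trmxCK. Qed.

Lemma upper_star b : upper b -> lower (SL_star b).
Proof.
move=> /is_trig_mxP ub; apply/is_trig_mxP => i j ij.
by have := ub i j ij; rewrite !mxE => ->; rewrite rmorph0.
Qed.

Lemma Hchar_star (a : SLweight n) b : Hchar a (SL_star b) = (Hchar a b)^*.
Proof.
rewrite /Hchar rmorph_prod; apply: eq_bigr => j _; rewrite fmorphXz /=.
by rewrite rmorph_prod; congr (exprz _ _); apply: eq_bigr => i _; rewrite !mxE.
Qed.

Lemma Gchar_star (l : Gweight n) b : Gchar l (Gstar b) = (Gchar l b)^*.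
Proof. by rewrite /Gchar !Hchar_star rmorphM. Qed.

(* Row vectors carry the left action [g . v = v *m A g], so [A] reverses
   products. *)
Definition star_rep N (A : G -> 'M[C]_N) : Prop :=
  [/\ forall i j, regG (fun g => A g i j),
      forall g h, A (g * h)%g = A h *m A g,
      A 1%g = 1%:M
    & forall g, A (Gstar g) = (A g)^t*].

Definition star_coef (f : G -> C) : Prop :=
  exists (N : nat) (A : G -> 'M[C]_N) (v w : 'rV_N),
    star_rep A /\ forall g, f g = (v *m A g *m w^t*) 0 0.

Lemma tr_conj_mul m k p (A : 'M[C]_(m, k)) (B : 'M_(k, p)) :
  (A *m B)^t* = B^t* *m A^t*.
Proof. by rewrite trmx_mul map_mxM. Qed.

(** Constants come from the trivial representation, sums from direct sums, products from tensor
    products, all compatible with the star. *)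
Lemma star_coef_subalg : fun_subalg star_coef.
Proof.
have hs := regular_subalg (@Gcoord C n).
split=> [c | f f' [N [A [v [w [[rA AM A1 As] e]]]]] [N' [A' [v' [w' [[rA' AM' A1' As'] e']]]]]
           | f f' [N [A [v [w [[rA AM A1 As] e]]]]] [N' [A' [v' [w' [[rA' AM' A1' As'] e']]]]]].
- exists 1%N, (fun=> 1%:M), c%:M, 1%:M; split; first split=> *.
  + exact: subalg_const.
  + by rewrite mulmx1.
  + by [].
  + by rewrite trmx1 map_mx1.
  + by rewrite trmx1 map_mx1 !mulmx1 mxE eqxx mulr1n.
- exists (N + N')%N, (fun g => block_mx (A g) 0 0 (A' g)), (row_mx v v'), (row_mx w w').
  split; first split.
  + move=> i j; case: (split_ordP i) => a ->; case: (split_ordP j) => b ->.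
    * by apply: subalg_ext (rA a b) _ => g; rewrite block_mxEul.
    * by apply: subalg_ext (subalg_const hs 0) _ => g; rewrite block_mxEur mxE.
    * by apply: subalg_ext (subalg_const hs 0) _ => g; rewrite block_mxEdl mxE.
    * by apply: subalg_ext (rA' a b) _ => g; rewrite block_mxEdr.
  + by move=> g h; rewrite mulmx_block !mulmx0 !mul0mx !addr0 !add0r AM AM'.
  + by rewrite A1 A1' -scalar_mx_block.
  + by move=> g; rewrite tr_block_mx map_block_mx !trmx0 !map_mx0 As As'.
  + move=> g; rewrite tr_row_mx map_col_mx mul_row_block !mulmx0 addr0 add0r.
    by rewrite mul_row_col mxE e e'.
- exists (N * N')%N, (fun g => A g *t A' g), (v *t v'), (w *t w').
  split; first split.
  + move=> i j; case: (mxtens_indexP i) => a a'; case: (mxtens_indexP j) => b b'.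
    by apply: subalg_ext (subalg_mul hs (rA a b) (rA' a' b')) _ => g; rewrite tensmxE.
  + by move=> g h; rewrite tensmx_mul AM AM'.
  + rewrite A1 A1'; apply/matrixP => i j.
    case: (mxtens_indexP i) => a a'; case: (mxtens_indexP j) => b b'.
    by rewrite tensmxE !mxE -natrM mulnb (inj_eq (can_inj (@mxtens_indexK N N'))) xpair_eqE.
  + by move=> g; rewrite trmx_tens map_mxT As As'.
  + move=> g.
    have h (x y : 'I_(1 * 1)) :
        ((v *t v') *m (A g *t A' g) *m (w *t w')^t*) x y = f g * f' g.
      rewrite trmx_tens map_mxT tensmx_mul tensmx_mul e e'.
      case: (mxtens_indexP x) => a a'; case: (mxtens_indexP y) => b b'.
      by rewrite tensmxE !ord1.
    by rewrite -(h 0 0).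
Qed.

(** The entries are coefficients of the standard representation, transposed because [A] reverses
    products. *)
Lemma regG_star_coef f : regG f -> star_coef f.
Proof.
have hs := regular_subalg (@Gcoord C n).
have aux (pr : G -> H) : (forall i j, regG (fun g => pr g i j)) ->
    (forall g h, pr (g * h)%g = (pr g * pr h)%g) -> pr 1%g = 1%g ->
    (forall g, pr (Gstar g) = SL_star (pr g)) ->
    forall i j, star_coef (fun g => pr g i j).
  move=> rp pM p1 ps i j.
  exists n.+1, (fun g => (pr g : 'M_n.+1)^T), (delta_mx 0 j), (delta_mx 0 i).
  split; first split.
  - by move=> a b; apply: subalg_ext (rp b a) _ => g; rewrite mxE.
  - by move=> g h; rewrite pM slmxM trmx_mul.
  - by rewrite p1 slmx1 trmx1.
  - by move=> g; rewrite ps /= map_trmx.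
  - move=> g; rewrite -rowE mxE (bigD1 i) //= big1 => [|k ki].
      by rewrite !mxE !eqxx rmorph1 mulr1 addr0.
    by rewrite !mxE (negbTE ki) rmorph0 mulr0.
move=> rf; apply: (@regG_subst C n G star_coef f id star_coef_subalg rf).
  by apply: (aux (fun g => g.1)) => // i j; apply: regG_fst.
by apply: (aux (fun g => g.2)) => // i j; apply: regG_snd.
Qed.

(** The span of an orbit as a least row space: take one of minimal rank, the intersection of two
    candidates being a candidate. *)
Lemma exists_orbit_space N (A : G -> 'M[C]_N) (w : 'rV_N) :
  exists S : 'M_N, (forall g, (w *m A g <= S)%MS) /\
    forall S' : 'M_N, (forall g, (w *m A g <= S')%MS) -> (S <= S')%MS.
Proof.
pose D d := `[< exists S : 'M_N, \rank S = d /\ forall g, (w *m A g <= S)%MS >].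
have ex : exists d, D d.
  exists (\rank (1%:M : 'M[C]_N)); apply/asboolP; exists 1%:M; split=> // g.
  exact: submx1.
case: (ex_minnP ex) => d /asboolP[S [dS hS]] mind.
exists S; split=> // S' hS'.
have /mind : D (\rank (S :&: S')%MS).
  by apply/asboolP; exists (S :&: S')%MS; split=> // g; rewrite sub_capmx hS hS'.
rewrite -dS => le; apply: submx_trans (capmxSr S S').
by rewrite -(mxrank_leqif_sup (capmxSl S S')).2 eqn_leq le mxrankS ?capmxSl.
Qed.

Lemma dotmx_eq0 N (y : 'rV[C]_N) : y *m y^t* = 0 -> y = 0.
Proof.
move=> h; apply/eqP/negPn/negP => /dotmx_is_dotmx.
by rewrite dotmxE h mxE ltxx.
Qed.

Lemma mx11_eq0 (x : 'M[C]_1) : x 0 0 = 0 -> x = 0.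
Proof. by move=> h; apply/matrixP => i j; rewrite !ord1 h mxE. Qed.

Section OrbitSpace.
Variables (N : nat) (A : G -> 'M[C]_N) (hA : star_rep A) (w : 'rV[C]_N) (S : 'M[C]_N).
Hypotheses (wS : forall g, (w *m A g <= S)%MS)
  (minS : forall S' : 'M_N, (forall g, (w *m A g <= S')%MS) -> (S <= S')%MS).

Lemma orbit_gen_sub : (w <= S)%MS.
Proof. by case: hA => _ _ A1 _; have := wS 1%g; rewrite A1 mulmx1. Qed.

(** S A(g^-1) contains the orbit as well, so minimality gives S <= S A(g^-1). *)
Lemma orbit_inv g : (S *m A g <= S)%MS.
Proof.
case: hA => _ AM A1 _.
have AV : A g^-1%g *m A g = 1%:M by rewrite -AM mulgV A1.
have : (S <= S *m A g^-1%g)%MS.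
  apply: minS => h; have -> : w *m A h = w *m A (g * h)%g *m A g^-1%g.
    by rewrite -mulmxA -AM mulgA mulVg mul1g.
  exact: submxMr.
by move/(submxMr (A g)); rewrite -mulmxA AV mulmx1.
Qed.

Lemma orbit_orthogonal (y : 'rV_N) : (forall g, w *m A g *m y^t* = 0) -> S *m y^t* = 0.
Proof.
move=> h; apply/sub_kermxP; apply: minS => g; apply/sub_kermxP; exact: h.
Qed.

Lemma orbit_orthogonal_coef (y : 'rV_N) :
  (forall g, (y *m A g *m w^t*) 0 0 = 0) -> S *m y^t* = 0.
Proof.
move=> h; apply: orbit_orthogonal => g; case: hA => _ _ _ As.
have -> : w *m A g *m y^t* = (y *m A (Gstar g) *m w^t*)^t*.
  by rewrite !tr_conj_mul trmxCK -As GstarK mulmxA.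
by rewrite (mx11_eq0 (h _)) trmx0 map_mx0.
Qed.

(** As A g^* is the adjoint of A g, vanishing coefficients make y orthogonal to the orbit of w,
    hence to S and to itself. *)
Lemma orbit_coef_eq0 (y : 'rV_N) : (y <= S)%MS ->
  (forall g, (y *m A g *m w^t*) 0 0 = 0) -> y = 0.
Proof.
move=> /submxP[D ->] h; apply: dotmx_eq0.
by rewrite -mulmxA orbit_orthogonal_coef ?mulmx0.
Qed.

End OrbitSpace.

(** Transposition exchanges lower and upper unipotents and restores the usual order of products. *)
Lemma exists_upper_fixed N (A : G -> 'M[C]_N) (U : 'M_N) : star_rep A ->
  U != 0 -> (forall g, (U *m A g <= U)%MS) ->
  exists u : 'rV_N, [/\ u != 0, (u <= U)%MS & forall g, Gunip g -> u *m A g = u].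
Proof.
move=> [rA AM A1 _] U0 hU.
have [||||u [u0 uU hu]] := @exists_unip_fixed C n N (fun g => A (Gtr g)) U _ _ _ U0.
- move=> i j; apply: (@regG_subst C n G _ _ Gtr (regular_subalg _) (rA i j)) => a b.
    by apply: subalg_ext (regG_fst C b a) _ => g; rewrite mxE.
  by apply: subalg_ext (regG_snd C b a) _ => g; rewrite mxE.
- by move=> g h; rewrite GtrM AM.
- by rewrite Gtr1.
- by move=> g.
exists u; split=> // g [[u1 n1] [u2 n2]].
rewrite -[g]GtrK hu //; split; split => //; move=> i; rewrite /= mxE; [exact: n1 | exact: n2].
Qed.

(* Irreducibility of the span of an orbit of a highest weight vector: two
   complementary invariant subspaces would contain unipotent-fixed vectors with
   proportional, nonzero matrix coefficients against [w]. *)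
Lemma orbit_irreducible N (A : G -> 'M[C]_N) (w : 'rV_N) (S U : 'M_N) l :
  star_rep A -> (forall g, (w *m A g <= S)%MS) ->
  (forall S' : 'M_N, (forall g, (w *m A g <= S')%MS) -> (S <= S')%MS) ->
  (forall b, Gborel b -> w *m A b = Gchar l b *: w) ->
  (U <= S)%MS -> U != 0 -> (forall g, (U *m A g <= U)%MS) -> (S <= U)%MS.
Proof.
move=> hA wS minS hw US U0 hU; have [rA AM A1 As] := hA.
apply/negPn/negP => SU.
(* The orthogonal complement of U in S, invariant because the adjoint of each A g is again in the
   image of A. *)
pose U2 := (S :&: kermx (U^t*))%MS.
have U2P (x : 'rV_N) : (x <= U2)%MS = (x <= S)%MS && (x *m U^t* == 0).
  by rewrite sub_capmx; congr andb; apply/sub_kermxP/eqP.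
have hU2 g : (U2 *m A g <= U2)%MS.
  apply/row_subP => i; rewrite row_mul; set x := row i U2.
  have : (x <= U2)%MS by apply: row_sub.
  rewrite !U2P => /andP[xS /eqP xU]; apply/andP; split.
    by apply: submx_trans (orbit_inv hA wS minS g); apply: submxMr.
  have -> : x *m A g *m U^t* = x *m (U *m A (Gstar g))^t*.
    by rewrite tr_conj_mul As trmxCK mulmxA.
  have /submxP[D ->] := hU (Gstar g).
  by rewrite tr_conj_mul mulmxA xU mul0mx.
have U20 : U2 != 0.
  have [i hi] : exists i, ~~ (row i S <= U)%MS.
    by apply/existsP; rewrite -negb_forall; apply: contra SU => /forallP h; apply/row_subP.
  set s := row i S in hi.
  have : (s - s *m proj_ortho U <= U2)%MS.
    rewrite U2P; apply/andP; split.
      by rewrite addmx_sub ?row_sub // eqmx_opp (submx_trans (proj_ortho_sub _ _)).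
    have := proj_ortho_compl_sub U s; rewrite orthomx1E => /eqP ->.
    by [].
  apply: contraL => /eqP -> ; rewrite submx0 subr_eq0; apply: contra hi => /eqP ->.
  exact: proj_ortho_sub.
have [u1 [u10 u1U hu1]] := exists_upper_fixed hA U0 hU.
have [u2 [u20 u2U hu2]] := exists_upper_fixed hA U20 hU2.
move: u2U; rewrite U2P => /andP[u2S /eqP u2U].
have u1S : (u1 <= S)%MS := submx_trans u1U US.
have u12 : u2 *m u1^t* = 0.
  by have /submxP[D ->] := u1U; rewrite tr_conj_mul mulmxA u2U mul0mx.
pose F (u : 'rV_N) g := (u *m A g *m w^t*) 0 0.
have Freg u : regG (F u).
  have hs := regular_subalg (@Gcoord C n).
  have e : (fun g => \sum_j (\sum_i u 0 i * A g i j) * (w 0 j)^*) =1 F u.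
    move=> g; rewrite /F mxE; apply: eq_bigr => j _; rewrite !mxE; congr (_ * _).
  apply: subalg_ext _ e; apply: subalg_sum => // j _; apply: subalg_mul => //.
    by apply: subalg_sum => // i _; apply: subalg_mul => //; apply: subalg_const.
  exact: subalg_const.
have Fcell (u : 'rV_N) b g : Glower b -> Gunip g -> u *m A g = u ->
    F u (b * g)%g = (Gchar l (Gstar b))^* * F u 1%g.
  move=> [lb1 lb2] ug eu; rewrite /F AM mulmxA eu A1 mulmx1 -mulmxA.
  have -> : A b *m w^t* = (Gchar l (Gstar b))^* *: w^t*.
    have -> : A b *m w^t* = (w *m A (Gstar b))^t* by rewrite tr_conj_mul As trmxCK.
    rewrite hw; first by rewrite linearZ /= map_mxZ.
    by split; apply/upperP; rewrite /upper /= map_trmx trmxK; apply/is_trig_mxP => i j ij;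
      rewrite mxE; [move/is_trig_mxP: lb1 => -> | move/is_trig_mxP: lb2 => ->]; rewrite ?rmorph0.
  by rewrite -scalemxAr mxE.
have Fzero (u : 'rV_N) : (u <= S)%MS -> (forall g, Gunip g -> u *m A g = u) ->
    F u 1%g = 0 -> u = 0.
  move=> uS hu Fu; apply: (orbit_coef_eq0 hA minS uS) => g.
  apply: (regG_dense (Freg u)) => b g' lb ug.
  by rewrite Fcell ?hu // Fu mulr0.
have n1 : F u1 1%g != 0 by apply: contraNneq u10 => /(Fzero _ u1S hu1) ->.
(* Chosen so that its coefficient vanishes at 1, whence y = 0. Pairing with u2, orthogonal to u1,
   then forces u2 to have norm 0. *)
pose y := F u2 1%g *: u1 - F u1 1%g *: u2.
have y0 : y = 0.
  apply: Fzero.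
  - by rewrite addmx_sub ?eqmx_opp ?scalemx_sub.
  - by move=> g ug; rewrite mulmxBl -!scalemxAl hu1 // hu2.
  - rewrite /F !mulmxBl -!scalemxAl mxE mxE [X in _ + X]mxE [X in _ - X]mxE.
    by rewrite -/(F u1 1%g) -/(F u2 1%g) mulrC subrr.
have : u2 *m y^t* = 0 by rewrite y0 trmx0 map_mx0 mulmx0.
rewrite /y linearB /= map_mxB !linearZ /= !map_mxZ mulmxBr -!scalemxAr u12 scaler0 sub0r.
move/eqP; rewrite oppr_eq0 scaler_eq0 conjC_eq0 (negbTE n1) /= => /eqP/dotmx_eq0 e.
by rewrite e eqxx in u20.
Qed.

End StarRepresentations.

(** * Representations on invariant row spaces *)

Section SubRepresentations.
Variables (C : numClosedFieldType) (n : nat).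
Local Notation H := (SL C n.+1).
Local Notation G := (H * H)%type.
Local Notation regG := (@regular_fun C G _ (@Gcoord C n)).

Definition submx_of_vspace r (U : {vspace 'rV[C]_r}) : 'M[C]_(\dim U, r) :=
  \matrix_(i < \dim U) (vbasis U)`_i.

Lemma submx_of_vspaceP r (U : {vspace 'rV[C]_r}) (x : 'rV_r) :
  (x <= submx_of_vspace U)%MS = (x \in U).
Proof.
apply/idP/idP => [/submxP[D ->]|xU].
  rewrite mulmx_sum_row memv_suml // => i _; rewrite rowK memvZ //.
  by apply: vbasis_mem; apply: mem_nth; rewrite size_tuple.
rewrite (coord_vbasis xU); apply: summx_sub => i _; apply: scalemx_sub.
rewrite (_ : (vbasis U)`_i = row i (submx_of_vspace U)) ?row_sub //.
by rewrite rowK.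
Qed.

Variables (N : nat) (A : G -> 'M[C]_N) (hA : star_rep A) (S : 'M[C]_N).
Hypothesis invS : forall g, (S *m A g <= S)%MS.

Definition sub_mx (g : G) : 'M[C]_(\rank S) :=
  row_base S *m A g *m pinvmx (row_base S).

Definition sub_rep (g : G) : 'End('rV[C]_(\rank S)) := linfun (mulmxr (sub_mx g)).

Lemma sub_mxE g : sub_mx g *m row_base S = row_base S *m A g.
Proof.
rewrite /sub_mx mulmxKpV // (submx_trans _ (_ : S <= _)%MS) ?eq_row_base //.
by apply: submx_trans (invS g); apply: submxMr; rewrite eq_row_base.
Qed.

Lemma sub_repE g x : sub_rep g x = x *m sub_mx g.
Proof. by rewrite /sub_rep lfunE. Qed.

Lemma sub_repK g x : sub_rep g x *m row_base S = x *m row_base S *m A g.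
Proof. by rewrite sub_repE -(mulmxA x (sub_mx g)) sub_mxE mulmxA. Qed.

Lemma row_base_inj k (X Y : 'M[C]_(k, _)) :
  X *m row_base S = Y *m row_base S -> X = Y.
Proof. by move=> h; apply: (row_free_inj (row_base_free S)). Qed.

Lemma sub_rep_functional (f : 'Hom('rV[C]_(\rank S), C^o)) v :
  regG (fun g => f (sub_rep g v)).
Proof.
have hs := regular_subalg (@Gcoord C n); have [rA _ _ _] := hA.
have e : (fun g => \sum_i (v *m sub_mx g) 0 i * f (delta_mx 0 i)) =1
         (fun g => f (sub_rep g v)).
  move=> g; rewrite sub_repE {2}(row_sum_delta (v *m sub_mx g)) linear_sum.
  by apply: eq_bigr => i _; rewrite linearZ.
apply: subalg_ext _ e; apply: subalg_sum => // i _; apply: subalg_mul => //; last first.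
  exact: subalg_const.
apply: subalg_mulmx => // a b; first exact: subalg_const.
apply: subalg_mulmx => // a' b'; last exact: subalg_const.
by apply: subalg_mulmx => // a'' b''; apply: subalg_const.
Qed.

Lemma sub_rep1 : sub_rep 1%g = \1%VF.
Proof.
have [_ _ A1 _] := hA; apply/lfunP => x; apply: row_base_inj.
by rewrite sub_repK A1 mulmx1 id_lfunE.
Qed.

Lemma sub_repM g h : sub_rep (g * h)%g = (sub_rep g \o sub_rep h)%VF.
Proof.
have [_ AM _ _] := hA; apply/lfunP => x; apply: row_base_inj.
by rewrite comp_lfunE !sub_repK AM mulmxA.
Qed.

Hypothesis S0 : S != 0.

Lemma sub_rep_fullv : (fullv : {vspace 'rV[C]_(\rank S)}) <> 0%VS.
Proof.
move=> /(congr1 (@dimv _ _)); rewrite dimvf dimv0 /dim /= mul1n => /eqP.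
by rewrite mxrank_eq0 (negbTE S0).
Qed.

Hypothesis irrS : forall U : 'M_N, (U <= S)%MS -> U != 0 ->
  (forall g, (U *m A g <= U)%MS) -> (S <= U)%MS.

Lemma sub_rep_irr (U : {vspace 'rV[C]_(\rank S)}) :
  (forall g, (sub_rep g @: U <= U)%VS) -> U = 0%VS \/ U = fullv.
Proof.
move=> hU; pose M := submx_of_vspace U.
pose U1 : 'M[C]_N := <<M *m row_base S>>%MS.
have [e|U10] := eqVneq U1 0.
  left; apply/eqP; rewrite -subv0; apply/subvP => x; rewrite -submx_of_vspaceP memv0.
  move=> /(submxMr (row_base S)) h; apply/eqP; apply: row_base_inj; rewrite mul0mx.
  by apply/eqP; rewrite -submx0 -e genmxE.
right; apply/eqP; rewrite eqEsubv subvf /=; apply/subvP => x _.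
have : (S <= U1)%MS.
  apply: irrS => //.
    by rewrite genmxE (submx_trans (submxMl _ _)) // eq_row_base.
  move=> g; rewrite (eqmxMr _ (genmxE _)) genmxE.
  apply/row_subP => i; rewrite -mulmxA row_mul.
  have : sub_rep g (row i M) \in U.
    by apply: (subvP (hU g)); apply: memv_img; rewrite -submx_of_vspaceP row_sub.
  by rewrite -submx_of_vspaceP => /(submxMr (row_base S)); rewrite sub_repK mulmxA.
have xS : (x *m row_base S <= S)%MS by rewrite (submx_trans (submxMl _ _)) // eq_row_base.
move=> /(submx_trans xS); rewrite genmxE => /submxP[D]; rewrite (mulmxA D M) => e.
by rewrite (row_base_inj e) -submx_of_vspaceP submxMl.
Qed.

Lemma sub_rep_irreducible : irreducible_rep (@Gcoord C n) sub_rep.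
Proof.
split; last exact: sub_rep_irr; last exact: sub_rep_fullv.
by split=> [|g h|f v]; [exact: sub_rep1 | exact: sub_repM | exact: sub_rep_functional].
Qed.

End SubRepresentations.

(** * The modules attached to a spherical function *)

Section ToRepresentation.
Variables (C : numClosedFieldType) (n : nat).
Local Notation H := (SL C n.+1).
Local Notation G := (H * H)%type.
Local Notation regG := (@regular_fun C G _ (@Gcoord C n)).
Local Open Scope sesquilinear_scope.

Lemma spherical_PplusG (l : Gweight n) (mu : SLweight n) (F : G -> C) :
  Gdominant l -> spherical l mu F -> PplusG C mu l.
Proof.
move=> dl [rF [g0 Fg0] FL FR].
have [N [A [v [w [hA Fe]]]]] := regG_star_coef rF; have [rA AM A1 As] := hA.
(* Projecting [w] on the span of the orbit of [v] makes it a highest weight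
   vector; projecting [v] on the span of the orbit of the new [w], which is
   irreducible, makes it one for H. *)
have [T [vT minT]] := exists_orbit_space A v.
pose w' := w *m proj_ortho T.
have w'T : (w' <= T)%MS by apply: proj_ortho_sub.
have T_w : T *m w^t* = T *m w'^t*.
  have := proj_ortho_compl_sub T w; rewrite orthomx1E -/w' => /eqP h.
  apply/eqP; rewrite -subr_eq0 -mulmxBr -[X in _ *m X](_ : (w - w')^t* = _).
    by rewrite -[_ *m _]trmxCK tr_conj_mul trmxCK h trmx0 map_mx0.
  by rewrite linearB /= map_mxB.
have Fe' g : F g = (v *m A g *m w'^t*) 0 0.
  have /submxP[D e] := vT g.
  by rewrite Fe e -!mulmxA T_w.
(* The difference lies in T and, F being covariant under the lower matrix b^*, is orthogonal to the
   orbit of v, hence to itself. *)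
have w'eig b : Gborel b -> w' *m A b = Gchar l b *: w'.
  move=> [/upperP ub1 /upperP ub2]; apply/eqP; rewrite -subr_eq0; apply/eqP.
  set y := _ - _.
  have yT : (y <= T)%MS.
    rewrite addmx_sub ?eqmx_opp ?scalemx_sub //.
    by apply: submx_trans (orbit_inv hA vT minT b); apply: submxMr.
  have Ty : T *m y^t* = 0.
    apply: (orbit_orthogonal minT) => g; apply: mx11_eq0.
    rewrite /y linearB /= map_mxB linearZ /= map_mxZ mulmxBr mxE tr_conj_mul -As.
    rewrite mulmxA -(mulmxA v) -AM -scalemxAr [X in _ + X]mxE [X in _ - X]mxE -!Fe'.
    rewrite FL; last by split; apply: upper_star.
    by rewrite Gchar_star subrr.
  by have /submxP[D e] := yT; apply: dotmx_eq0; rewrite {1}e -mulmxA Ty mulmx0.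
have [S [w'S minS]] := exists_orbit_space A w'.
pose v' := v *m proj_ortho S.
have v'S : (v' <= S)%MS by apply: proj_ortho_sub.
have vS : (v - v') *m S^t* = 0.
  by apply/eqP; rewrite -orthomx1E; apply: proj_ortho_compl_sub.
have Fe2 g : F g = (v' *m A g *m w'^t*) 0 0.
  rewrite Fe' -{1}[v](subrK v') (mulmxDl (v - v')) (mulmxDl ((v - v') *m A g)) mxE.
  have -> : (v - v') *m A g *m w'^t* = (v - v') *m (w' *m A (Gstar g))^t*.
    by rewrite tr_conj_mul As trmxCK mulmxA.
  have /submxP[D ->] := w'S (Gstar g).
  by rewrite tr_conj_mul mulmxA vS mul0mx mxE add0r.
have v'eig b : upper b -> v' *m A (diag b) = Hchar mu b *: v'.
  move=> ub; apply/eqP; rewrite -subr_eq0; apply/eqP.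
  apply: (orbit_coef_eq0 hA minS).
    rewrite addmx_sub ?eqmx_opp ?scalemx_sub //.
    by apply: submx_trans (orbit_inv hA w'S minS (diag b)); apply: submxMr.
  move=> g; rewrite !mulmxBl -(mulmxA v') -AM -!scalemxAl mxE [X in _ + X]mxE.
  by rewrite [X in _ - X]mxE -!Fe2 FR // subrr.
have v'0 : v' != 0 by apply: contraNneq Fg0 => e; rewrite Fe2 e !mul0mx mxE.
have w'0 : w' != 0 by apply: contraNneq Fg0 => e; rewrite Fe' e trmx0 map_mx0 mulmx0 mxE.
have S0 : S != 0 by apply: contraNneq v'0 => e; rewrite -submx0 -e.
have invS := orbit_inv hA w'S minS.
split=> //; exists 'rV[C]_(\rank S), (sub_rep A S); split; first split.
- apply: sub_rep_irreducible => // U; exact: orbit_irreducible minS w'eig.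
- have /submxP[x ex] : (w' <= row_base S)%MS by rewrite eq_row_base (orbit_gen_sub hA).
  exists x; first by apply: contraNneq w'0 => e; rewrite ex e mul0mx.
  move=> b bb; apply: row_base_inj; rewrite sub_repK // -ex w'eig //.
  by rewrite -scalemxAl -ex.
(* The H-module is viewed as a G-module through the first factor, with weight (mu, 0), so that the
   results on orbits of G apply to it. *)
pose pr (g : G) : G := diag g.1.
have hA' : star_rep (fun g => A (pr g)).
  split=> [i j|g h||g]; [|exact: (AM (pr g) (pr h))|exact: A1|exact: (As (diag g.1))].
  by apply: (@regG_subst C n G _ _ pr (regular_subalg _) (rA i j)) => a b; apply: regG_fst.
have [Q [v'Q minQ]] := exists_orbit_space (fun g => A (pr g)) v'.
have invQ := orbit_inv hA' v'Q minQ.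
have Q0 : Q != 0.
  by apply: contraNneq v'0 => e; rewrite -submx0 -e; apply: (orbit_gen_sub hA').
have QS : (Q <= S)%MS by apply: minQ => g; apply: submx_trans (invS _); apply: submxMr.
have irrQ : irreducible_rep (@Gcoord C n) (sub_rep (fun g => A (pr g)) Q).
  apply: sub_rep_irreducible => // U.
  apply: (orbit_irreducible (l := (mu, 0)) hA' v'Q minQ) => b [/upperP ub _].
  by rewrite /Gchar Hchar0 mulr1; apply: v'eig.
have [[q1 qM qreg] qfull qirr] := irrQ.
exists 'rV[C]_(\rank Q), (fun h => sub_rep (fun g => A (pr g)) Q (h, 1%g)); split; first split.
- split=> //.
    split=> [|g h|f x]; first exact: q1.
      by rewrite -qM; congr (sub_rep _ _ (_, _)); rewrite mulg1.
    apply: (@regG_subst C n H _ _ (fun h => (h, 1%g)) (regular_subalg _) (qreg f x)) => i j.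
      exact: regH_coord.
    by apply: subalg_const; apply: regular_subalg.
  by move=> U hU; apply: qirr => g; apply: hU.
- have /submxP[x ex] : (v' <= row_base Q)%MS by rewrite eq_row_base (orbit_gen_sub hA').
  exists x; first by apply: contraNneq v'0 => e; rewrite ex e mul0mx.
  move=> b bb; apply: row_base_inj; rewrite sub_repK // -ex v'eig; last exact/upperP.
  by rewrite -scalemxAl -ex.
(* The inclusion of Q in S, written in the chosen bases. *)
pose K := row_base Q *m pinvmx (row_base S).
have KE : K *m row_base S = row_base Q by rewrite mulmxKpV // !eq_row_base.
have fK y : linfun (mulmxr K) y *m row_base S = y *m row_base Q.
  by rewrite lfunE -KE; exact: esym (mulmxA y K (row_base S)).
exists (linfun (mulmxr K)).
  apply/eqP/lker0P => x y /(congr1 (mulmx^~ (row_base S))).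
  by rewrite !fK => e; apply: (row_base_inj e).
move=> h x; apply: (@row_base_inj C N S).
rewrite fK (sub_repK invQ (h, 1%g) x) (sub_repK invS (diag h)).
by congr (_ *m _); rewrite fK.
Qed.

End ToRepresentation.

(** * Generators *)

Section StackedRows.
Variables (C : fieldType) (n N i : nat).
Hypotheses (iN : (i <= N)%N) (im : (i <= n.+1)%N) (Nm : (N - i <= n.+1)%N).

(** By Laplace expansion its determinant is a signed sum of products of an i-minor in the top rows
    of X and the complementary minor in the top rows of Y, whence the weight (omega_i, omega_(N-i)).
    The [inord] casts are exact as i and N - i are at most n + 1. *)
Definition stack (X Y : 'M[C]_(n.+1, N)) : 'M[C]_N :=
  \matrix_(r, c) if (r < i)%N then X (inord r) c else Y (inord (r - i)) c.

Definition stack_diag (b1 b2 : 'M[C]_n.+1) : 'M[C]_N :=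
  \matrix_(r, c) if (r < i)%N then (if (c < i)%N then b1 (inord r) (inord c) else 0)
    else if (c < i)%N then 0 else b2 (inord (r - i)) (inord (c - i)).

Lemma stack_mulr X Y (A : 'M[C]_N) : stack (X *m A) (Y *m A) = stack X Y *m A.
Proof.
apply/matrixP => r c; rewrite !mxE.
by case: ifP => ri; apply: eq_bigr => a _; rewrite mxE ri.
Qed.

(** A lower triangular matrix acts on the first rows through its leading block alone. *)
Lemma stack_mull (b1 b2 : 'M[C]_n.+1) X Y : is_trig_mx b1 -> is_trig_mx b2 ->
  stack (b1 *m X) (b2 *m Y) = stack_diag b1 b2 *m stack X Y.
Proof.
move=> /is_trig_mxP t1 /is_trig_mxP t2; apply/matrixP => r c; rewrite !mxE.
have rN := ltn_ord r.
case: ifP => ri.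
  pose f a := b1 (inord r) (inord a) * X (inord a) c.
  transitivity (\sum_(a < i) f a).
    rewrite (big_ord_widen _ f im) [LHS](bigID (fun a : 'I_n.+1 => (a < i)%N)) /=.
    rewrite [X in _ + X]big1 ?addr0 => [|a ai].
      by apply: eq_bigr => a _; rewrite /f inord_val.
    rewrite t1 ?mul0r // inordK; lia.
  rewrite (big_ord_widen _ f iN) [RHS](bigID (fun a : 'I_N => (a < i)%N)) /=.
  rewrite [X in _ = _ + X]big1 ?addr0 => [|a ai]; last by rewrite !mxE ri (negbTE ai) mul0r.
  by apply: eq_bigr => a ai; rewrite !mxE ri ai.
pose f a := b2 (inord (r - i)) (inord a) * Y (inord a) c.
transitivity (\sum_(a < N - i) f a).
  rewrite (big_ord_widen _ f Nm) [LHS](bigID (fun a : 'I_n.+1 => (a < N - i)%N)) /=.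
  rewrite [X in _ + X]big1 ?addr0 => [|a ai].
    by apply: eq_bigr => a _; rewrite /f inord_val.
  rewrite t2 ?mul0r // inordK; lia.
rewrite [RHS](bigID (fun a : 'I_N => (a < i)%N)) /=.
rewrite [X in _ = X + _]big1 ?add0r => [|a ai]; last by rewrite !mxE ri ai mul0r.
pose h a := f (a - i)%N.
transitivity (\sum_(0 + i <= a < N) h a).
  rewrite big_addn big_mkord; apply: eq_bigr => a _.
  by rewrite /h addnK.
rewrite big_geq_mkord /=; apply: eq_big => [a|a ia]; first by rewrite -leqNgt.
by rewrite !mxE ri ltnNge (_ : (i <= a)%N).
Qed.

Lemma det_stack_diag (b1 b2 : 'M[C]_n.+1) : is_trig_mx b1 -> is_trig_mx b2 ->
  \det (stack_diag b1 b2) =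
  (\prod_(r < n.+1 | (r < i)%N) b1 r r) * \prod_(r < n.+1 | (r < N - i)%N) b2 r r.
Proof.
move=> /is_trig_mxP t1 /is_trig_mxP t2; rewrite det_trig; last first.
  apply/is_trig_mxP => r c rc; rewrite !mxE; have rN := ltn_ord r; have cN := ltn_ord c.
  case: (ltnP r i) => ri; case: (ltnP c i) => ci //.
  - by rewrite t1 // !inordK; lia.
  - by rewrite t2 // !inordK; lia.
pose f1 a := b1 (inord a) (inord a); pose f2 a := b2 (inord a) (inord a).
transitivity ((\prod_(a < i) f1 a) * \prod_(a < N - i) f2 a); last first.
  rewrite (big_ord_widen _ f1 im) (big_ord_widen _ f2 Nm).
  by congr (_ * _); apply: eq_bigr => a _; rewrite /f1 /f2 inord_val.
rewrite (bigID (fun r : 'I_N => (r < i)%N)) /=; congr (_ * _).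
  by rewrite (big_ord_widen _ f1 iN); apply: eq_bigr => r ri; rewrite mxE ri.
transitivity (\prod_(0 + i <= a < N) f2 (a - i)%N).
  rewrite big_geq_mkord /=; apply: eq_big => [a|a ia]; first by rewrite -leqNgt.
  by rewrite mxE (negbTE ia).
rewrite big_addn big_mkord; apply: eq_bigr => a _.
by rewrite addnK.
Qed.

End StackedRows.

Section Generators.
Variables (C : numClosedFieldType) (n : nat).
Local Notation H := (SL C n.+1).
Local Notation G := (H * H)%type.
Local Notation regG := (@regular_fun C G _ (@Gcoord C n)).

(** The convention omega_0 = omega_(n+1) = 0 agrees with the empty product and with determinant
    1. *)
Lemma Hchar_omega i (b : H) : (i <= n.+1)%N -> lower b \/ upper b ->
  Hchar (omega n i) b = \prod_(r < n.+1 | (r < i)%N) b r r.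
Proof.
move=> im tb; rewrite /Hchar.
have [->|i0] := posnP i.
  rewrite big1 => [|j _]; first by rewrite big_pred0.
  by rewrite mxE expr0z.
have [ni|] := ltnP n i.
  rewrite big1 => [|j _]; last first.
    by rewrite mxE (_ : (j.+1 == i) = false) ?expr0z //; have := ltn_ord j; lia.
  rewrite (eq_bigl xpredT) => [|r]; last by have := ltn_ord r; lia.
  case: tb => tb; first by rewrite -det_trig // det_slmx.
  apply: etrans (esym (det_slmx b)) _; rewrite -det_tr det_trig //.
  by apply: eq_bigr => r _; rewrite mxE.
case: i i0 im => // i _ im ni.
rewrite (bigD1 (Ordinal ni)) //= [X in _ * X]big1 => [|j ji]; last first.
  by rewrite mxE eqSS (_ : (j == i :> nat) = false) ?expr0z //; apply: negbTE.
by rewrite mxE /= eqxx expr1z mulr1; apply: eq_bigl => r; rewrite ltnS.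
Qed.

(** Row r - i has its entry in column r, so the pair (1, [shift_SL i]) makes the stacked matrices
    triangular with nonzero diagonal. *)
Definition shift_perm (i : nat) : 'S_n.+1 := perm (addIr (inZp i : 'I_n.+1)).

Definition shift_SL (i : nat) : H := toSL (det_normalize (perm_mx (shift_perm i))).

Lemma shift_permE i (r : 'I_n.+1) : shift_perm i r = ((r + i) %% n.+1)%N :> nat.
Proof. by rewrite permE /= modnDmr. Qed.

Lemma shift_SLE i : exists k : 'I_n.+1 -> C, (forall a, k a != 0) /\
  forall a c, shift_SL i a c = k a * (shift_perm i a == c)%:R.
Proof.
have d0 : \det (perm_mx (shift_perm i) : 'M[C]_n.+1) != 0 by rewrite det_perm signr_eq0.
exists (fun a => if a == 0 then (\det (perm_mx (shift_perm i)))^-1 else 1); split.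
  by move=> a; case: ifP => _; rewrite ?invr_neq0 ?oner_neq0.
by move=> a c; rewrite toSLE ?det_det_normalize // det_normalizeE !mxE.
Qed.

Lemma stack_regular N i (E0 E1 : 'M[C]_(n.+1, N)) r c :
  regG (fun g : G => stack i (g.1 *m E0) (g.2 *m E1) r c).
Proof.
have hs := regular_subalg (@Gcoord C n).
have h1 a b : regG (fun g : G => (g.1 *m E0) a b).
  by apply: subalg_mulmx => // x y; [exact: regG_fst | exact: subalg_const].
have h2 a b : regG (fun g : G => (g.2 *m E1) a b).
  by apply: subalg_mulmx => // x y; [exact: regG_snd | exact: subalg_const].
case: (boolP (r < i)%N) => ri.
  by apply: subalg_ext (h1 (inord r) c) _ => g; rewrite [RHS]mxE ri.
by apply: subalg_ext (h2 (inord (r - i)) c) _ => g; rewrite [RHS]mxE (negbTE ri).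
Qed.

Lemma stack_lower N i (E0 E1 : 'M[C]_(n.+1, N)) (b g : G) :
  (i <= N)%N -> (i <= n.+1)%N -> (N - i <= n.+1)%N -> Glower b ->
  \det (stack i ((b * g)%g.1 *m E0) ((b * g)%g.2 *m E1)) =
  Gchar (omega n i, omega n (N - i)) b * \det (stack i (g.1 *m E0) (g.2 *m E1)).
Proof.
move=> iN im Nm [lb1 lb2]; rewrite !slmxM -!mulmxA stack_mull // det_mulmx.
rewrite det_stack_diag // /Gchar !Hchar_omega //; by left.
Qed.

Lemma spherical_invariant i : (i <= n.+1)%N ->
  exists F : G -> C, spherical (omega n i, omega n (n.+1 - i)) 0 F.
Proof.
move=> im; exists (fun g : G => \det (stack i (g.1 *m 1%:M) (g.2 *m 1%:M))); split.
- by apply: subalg_det; [exact: regular_subalg | exact: stack_regular].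
- exists (1%g, shift_SL i); have [k [k0 hk]] := shift_SLE i.
  rewrite !mulmx1 det_trig.
    apply/prodf_neq0 => r _; rewrite mxE; case: (ltnP r i) => ri.
      by rewrite slmx1 mxE inord_val eqxx oner_neq0.
    have rn := ltn_ord r; have e : shift_perm i (inord (r - i)) = r.
      apply: ord_inj; rewrite shift_permE inordK; last lia.
      by rewrite subnK // modn_small.
    by rewrite hk e eqxx mulr1.
  apply/is_trig_mxP => r c rc; rewrite mxE; case: (ltnP r i) => ri.
    by rewrite slmx1 mxE inord_val (_ : (r == c) = false) // -val_eqE ltn_eqF.
  have rn := ltn_ord r; rewrite hk -val_eqE /= shift_permE inordK; last lia.
  by rewrite subnK // modn_small // ltn_eqF ?mulr0.
- by move=> b g lb; apply: stack_lower => //; apply: leq_subr.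
- move=> b g ub; rewrite Hchar0 mul1r !slmxM !mulmx1.
  by rewrite stack_mulr det_mulmx det_slmx mulr1.
Qed.

(* The weight omega_1 comes from the last column, which is 0 next to the rows of
   g1 and repeats the first column of g2 next to those of g2. *)
Lemma spherical_omega1 i : (0 < i <= n.+1)%N ->
  exists F : G -> C, spherical (omega n i, omega n (n.+2 - i)) (omega n 1) F.
Proof.
move=> /andP[i0 im].
pose E0 : 'M[C]_(n.+1, n.+1 + 1) := row_mx 1%:M 0.
pose E1 : 'M[C]_(n.+1, n.+1 + 1) := row_mx 1%:M (delta_mx 0 0).
exists (fun g : G => \det (stack i (g.1 *m E0) (g.2 *m E1))); split.
- by apply: subalg_det; [exact: regular_subalg | exact: stack_regular].
- exists (1%g, shift_SL i); have [k [k0 hk]] := shift_SLE i.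
  rewrite /E0 /E1 !mul_mx_row !mulmx1 mulmx0.
  have h1 (r c : 'I_(n.+1 + 1)) : (r < i)%N ->
      stack i (row_mx (1%g : H) 0)
        (row_mx (shift_SL i) (shift_SL i *m delta_mx 0 0 : 'cV_n.+1)) r c = (r == c)%:R :> C.
    move=> ri; rewrite mxE ri; case: (split_ordP c) => c' ->.
      by rewrite row_mxEl slmx1 mxE -!val_eqE /= inordK // (leq_trans ri).
    by rewrite row_mxEr mxE -val_eqE /= ltn_eqF // (leq_trans ri) // (leq_trans im) ?leq_addr.
  have h2 (r c : 'I_(n.+1 + 1)) : (i <= r)%N -> (r <= c)%N ->
      stack i (row_mx (1%g : H) 0)
        (row_mx (shift_SL i) (shift_SL i *m delta_mx 0 0 : 'cV_n.+1)) r c =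
      k (inord (r - i)) * (r == c)%:R.
    move=> ri rc; rewrite mxE ltnNge ri /=; have rn := ltn_ord r.
    have ro : (inord (r - i) : 'I_n.+1) = (r - i)%N :> nat by rewrite inordK; lia.
    case: (split_ordP c) rc => c' -> /= rc.
      rewrite row_mxEl hk -!val_eqE /= shift_permE ro subnK // modn_small //.
      by have := ltn_ord c'; lia.
    (* The last row wraps around to column 0 of the shift, which the last column repeats; the other
       rows meet it in 0 because i > 0. *)
    rewrite row_mxEr -colE mxE hk -!val_eqE /= shift_permE ro subnK //.
    congr (_ * (_ : bool)%:R); rewrite !ord1 /=.
    have [e|ne] := eqVneq (r : nat) n.+1; first by rewrite e modnn addn0 !eqxx.
    by rewrite modn_small ?addn0; lia.
  rewrite det_trig.
    apply/prodf_neq0 => r _; case: (ltnP r i) => ri.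
      by rewrite h1 // eqxx oner_neq0.
    by rewrite h2 // eqxx mulr1.
  apply/is_trig_mxP => r c rc; have rc' : (r == c) = false by rewrite -val_eqE ltn_eqF.
  case: (ltnP r i) => ri; first by rewrite h1 // rc'.
  by rewrite h2 ?(ltnW rc) // rc' mulr0.
- move=> b g lb; rewrite stack_lower //; try lia.
  by rewrite (_ : (n.+1 + 1 - i)%N = (n.+2 - i)%N) // addn1.
(* As b e_1 = b_11 e_1, both borders intertwine b with the block matrix diag(b, b_11), of
   determinant b_11. *)
- move=> b g ub; pose A : 'M_(n.+1 + 1) := block_mx b 0 0 (b 0 0)%:M.
  have e0 : b *m E0 = E0 *m A.
    by rewrite mul_mx_row mul_row_block !mulmx1 !mulmx0 !mul0mx mul1mx !addr0.
  have e1 : b *m E1 = E1 *m A.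
    rewrite mul_mx_row mul_row_block !mulmx1 !mulmx0 !mul1mx addr0 add0r.
    congr row_mx; rewrite -colE mul_mx_scalar; apply/matrixP => x y; rewrite !mxE !ord1.
    rewrite andbT; case: (eqVneq x 0) => [->|x0]; rewrite ?mulr1 ?mulr0 //.
    by move/upperP: ub => ->; rewrite // lt0n.
  rewrite !slmxM -!mulmxA e0 e1 !mulmxA stack_mulr det_mulmx.
  rewrite det_ublock det_slmx mul1r det_scalar1 mulrC; congr (_ * _).
  rewrite Hchar_omega //; last by right.
  rewrite (bigD1 ord0) //= big1 ?mulr1 // => r /andP[r1 /negP[]].
  by apply/eqP/ord_inj => /=; lia.
Qed.

End Generators.

(** * The upper bound *)

Section PlaneRotations.
Variables (C : fieldType) (m : nat).

Definition plane (j i : 'I_m) (a b c d : C) : 'M[C]_m :=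
  \matrix_(r, s) if r == j then (if s == j then a else if s == i then b else 0)
    else if r == i then (if s == j then c else if s == i then d else 0)
    else (r == s)%:R.

Variables (j i : 'I_m) (ji : (j < i)%N).

Lemma plane_neq : (i == j) = false.
Proof. by rewrite -val_eqE gtn_eqF. Qed.

Lemma planeM a b c d a' b' c' d' :
  plane j i a b c d *m plane j i a' b' c' d' =
  plane j i (a * a' + b * c') (a * b' + b * d') (c * a' + d * c') (c * b' + d * d').
Proof.
have ij := plane_neq.
apply/matrixP => r s; rewrite !mxE.
have [rj|rj] := eqVneq r j.
  rewrite (bigD1 j) //= (bigD1 i) ?ij //= big1 ?addr0 => [|t /andP[tj ti]].
    by rewrite !mxE rj !eqxx ij; case: (s == j); case: (s == i); rewrite ?mulr0 ?addr0.
  by rewrite !mxE rj eqxx (negbTE tj) (negbTE ti) mul0r.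
have [ri|ri] := eqVneq r i.
  rewrite (bigD1 j) //= (bigD1 i) ?ij //= big1 ?addr0 => [|t /andP[tj ti]].
    by rewrite !mxE ri !eqxx ij; case: (s == j); case: (s == i); rewrite ?mulr0 ?addr0.
  by rewrite !mxE ri ij eqxx (negbTE tj) (negbTE ti) mul0r.
rewrite (bigD1 r) //= big1 ?addr0 => [|t tr].
  by rewrite !mxE (negbTE rj) (negbTE ri) eqxx mul1r.
by rewrite !mxE (negbTE rj) (negbTE ri) eq_sym (negbTE tr) mul0r.
Qed.

Lemma plane_trig a c d : is_trig_mx (plane j i a 0 c d).
Proof.
apply/is_trig_mxP => r s rs; rewrite mxE.
case: (eqVneq r j) => [e|rj].
  case: (eqVneq s j) => [e'|_]; first by rewrite e e' ltnn in rs.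
  by case: ifP.
case: (eqVneq r i) => [e|ri]; last by rewrite -val_eqE ltn_eqF.
case: (eqVneq s j) => [e'|_]; first by move: rs ji; rewrite e e'; lia.
by case: (eqVneq s i) => [e'|_] //; rewrite e e' ltnn in rs.
Qed.

Lemma tr_plane a b c d : (plane j i a b c d)^T = plane j i a c b d.
Proof.
have ij := plane_neq.
apply/matrixP => r s; rewrite !mxE [s == r]eq_sym.
have [rj|rj] := eqVneq r j; have [sj|sj] := eqVneq s j => //.
- by rewrite rj [j == s]eq_sym (negbTE sj).
- by rewrite sj (negbTE rj).
have [ri|ri] := eqVneq r i; have [si|si] := eqVneq s i => //.
- by rewrite ri eq_sym (negbTE si).
- by rewrite si (negbTE ri).
Qed.

Lemma det_plane_lower a c d : \det (plane j i a 0 c d) = a * d.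
Proof.
have ij := plane_neq.
rewrite det_trig ?plane_trig // (bigD1 j) //= (bigD1 i) ?ij //= big1 ?mulr1 => [|t /andP[tj ti]].
  by rewrite !mxE !eqxx ij.
by rewrite mxE (negbTE tj) (negbTE ti) eqxx.
Qed.

Lemma det_plane_upper a b d : \det (plane j i a b 0 d) = a * d.
Proof. by rewrite -det_tr tr_plane det_plane_lower. Qed.

(** For d nonzero, factor into upper times lower; for d = 0, a shear first adds c, then nonzero, to
    d. *)
Lemma det_plane a b c d : a * d - b * c = 1 -> \det (plane j i a b c d) = 1.
Proof.
have aux a' b' c' d' : d' != 0 -> a' * d' - b' * c' = 1 -> \det (plane j i a' b' c' d') = 1.
  move=> d0 h; have -> : plane j i a' b' c' d' =
      plane j i 1 (b' / d') 0 1 *m plane j i (1 / d') 0 c' d'.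
    rewrite planeM; congr plane; try by field.
    apply: (mulIf d0).
    by transitivity (1 + b' * c'); [rewrite -h subrK | field].
  by rewrite det_mulmx det_plane_upper det_plane_lower mul1r; field.
move=> h; have [d0|] := eqVneq d 0; last by move=> /aux; apply.
have c0 : c != 0.
  by apply/eqP => c0; move: h; rewrite c0 d0 !mulr0 subrr => /eqP; rewrite eq_sym oner_eq0.
have <- : \det (plane j i a b c d *m plane j i 1 1 0 1) = \det (plane j i a b c d).
  by rewrite det_mulmx det_plane_upper !mulr1.
rewrite planeM; apply: aux; first by rewrite d0 !mulr1 addr0.
by rewrite -[RHS]h d0; ring.
Qed.

Lemma plane1 : plane j i 1 0 0 1 = 1%:M.
Proof.
have ij := plane_neq; apply/matrixP => r s; rewrite !mxE [r == s]eq_sym.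
have [->|rj] := eqVneq r j; first by case: (eqVneq s j) => // _; case: (s == i).
have [->|//] := eqVneq r i.
by case: (eqVneq s j) => [->|_]; rewrite ?[j == i]eq_sym ?ij //; case: (s == i).
Qed.

Lemma plane_diag a b c d r :
  plane j i a b c d r r = if r == j then a else if r == i then d else 1.
Proof. by rewrite mxE eqxx; case: (r == j); case: (r == i). Qed.

End PlaneRotations.

(** * Polynomial curves in SL and one-variable lemmas *)

Section PolynomialCurves.
Variables (C : numClosedFieldType) (n : nat).
Local Notation H := (SL C n.+1).
Local Notation G := (H * H)%type.
Local Notation regG := (@regular_fun C G _ (@Gcoord C n)).

Definition poly_curve (c : C -> H) := forall i j, rational_fun 1 (fun s => c s i j).

Lemma poly_curve_const g : poly_curve (fun=> g).
Proof. by move=> i j; apply: subalg_const; apply: rational_fun_subalg. Qed.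

Lemma poly_curveM c c' : poly_curve c -> poly_curve c' ->
  poly_curve (fun s => (c s * c' s)%g).
Proof. by move=> h h' i j; apply: subalg_mulmx => //; apply: rational_fun_subalg. Qed.

Lemma poly_curve_plane (j i : 'I_n.+1) (a b c d : {poly C}) : (j < i)%N ->
  a * d - b * c = 1 ->
  poly_curve (fun s => toSL (plane j i a.[s] b.[s] c.[s] d.[s])).
Proof.
move=> ji h r t.
have e : (fun s => plane j i a.[s] b.[s] c.[s] d.[s] r t) =1
    (fun s => toSL (plane j i a.[s] b.[s] c.[s] d.[s]) r t).
  move=> s; rewrite toSLE //; apply: det_plane => //.
  by rewrite -!hornerM -hornerN -hornerD h hornerC.
apply: subalg_ext _ e.
exists (if r == j then (if t == j then a else if t == i then b else 0)
    else if r == i then (if t == j then c else if t == i then d else 0)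
    else (r == t)%:R), 0%N => s _; rewrite expr0 mul1r mxE.
do 4?[case: ifP => _]; rewrite ?horner0 //.
by case: (r == t); rewrite ?hornerC ?horner0.
Qed.

Lemma regG_poly_curve (f : G -> C) c c' : regG f -> poly_curve c -> poly_curve c' ->
  exists P : {poly C}, forall s, f (c s, c' s) = P.[s].
Proof.
move=> rf h h'; apply: rational_fun1.
exact: (@regG_subst C n C _ _ (fun s => (c s, c' s)) (rational_fun_subalg 1) rf h h').
Qed.

End PolynomialCurves.

(** A regular function on the projective line is constant: X^(size Q) P is the reversal of Q, whose
    size leaves P degree at most 0. *)
Lemma poly_inverse_const (C : numFieldType) (P Q : {poly C}) :
  (forall z, z != 0 -> P.[z] = Q.[z^-1]) -> forall z, P.[z] = P.[0].
Proof.
move=> h.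
pose R : {poly C} := \poly_(i < (size Q).+1) Q`_(size Q - i).
have e : 'X^(size Q) * P = R.
  apply: poly_eq_ext => z z0; rewrite hornerM hornerXn h // horner_poly.
  rewrite (horner_coef_wide _ (leqnSn _)) big_distrr /= (reindex_inj rev_ord_inj) /=.
  apply: eq_bigr => i _; rewrite subSS exprVn mulrCA; congr (_ * _).
  have iQ : (i <= size Q)%N by have := ltn_ord i.
  by rewrite -{1}(subnK iQ) exprD; have := expf_neq0 (size Q - i) z0; move=> ?; field.
have sP : (size P <= 1)%N.
  have [->|P0] := eqVneq P 0; first by rewrite size_poly0.
  have := size_poly (size Q).+1 (fun i => Q`_(size Q - i)).
  rewrite -/R -e size_monicM ?monicXn // size_polyXn.
  by have := size_poly_gt0 P; rewrite P0; lia.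
by move=> z; rewrite (size1_polyC sP) !hornerC.
Qed.

(** For E >= 0 compare the coefficients of X^E in P(X^m) = a X^E; a negative E is excluded by
    evaluating X^(-E) P(X^m) = a at 0. *)
Lemma monomial_exponent (C : numFieldType) (m : nat) (P : {poly C}) (E : int) (a : C) :
  (0 < m)%N -> a != 0 -> (forall c, c != 0 -> P.[c ^+ m] = c ^ E * a) ->
  exists k : nat, E = (m * k)%N.
Proof.
move=> m0 a0 h; case: E h => e h.
  have id : P \Po 'X^m = a *: 'X^e.
    apply: poly_eq_ext => c c0.
    by rewrite horner_comp hornerZ !hornerXn h // mulrC.
  have := congr1 (fun p : {poly C} => p`_e) id.
  rewrite coef_comp_poly_Xn // coefZ coefXn eqxx mulr1.
  case: ifP => [/dvdnP[k ->] _|_ /eqP]; first by exists k; rewrite mulnC.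
  by rewrite eq_sym (negbTE a0).
have id : 'X^(e.+1) * (P \Po 'X^m) = a%:P.
  apply: poly_eq_ext => c c0.
  rewrite hornerM horner_comp !hornerXn hornerC h //.
  by rewrite -[c ^ Negz e]/(c ^- e.+1) mulrA mulfV ?mul1r // expf_neq0.
have := congr1 (fun p : {poly C} => p.[0]) id.
rewrite hornerM hornerXn hornerC expr0n mul0r => /eqP.
by rewrite eq_sym (negbTE a0).
Qed.

Lemma exists_root (C : numClosedFieldType) (m : nat) (x : C) : (0 < m)%N ->
  exists y, y ^+ m = x.
Proof. by move=> m0; exists (m.-root x); rewrite rootCK. Qed.

(** * The monomial on the open torus orbit and its exponents *)

Section OpenOrbit.
Variables (C : numClosedFieldType) (n : nat) (n_gt0 : (0 < n)%N).
Local Notation H := (SL C n.+1).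
Local Notation G := (H * H)%type.
Local Notation regG := (@regular_fun C G _ (@Gcoord C n)).

(* [Phi (x, y)] is F (x, w0 y) for a spherical function F, which turns the
   covariance under lower matrices on the right factor into one under upper
   matrices; [psi] is its restriction to a slice meeting the open orbit. *)
Variables (Phi : G -> C) (la nu : SLweight n) (k : nat).
Hypotheses (rPhi : regG Phi)
  (PhiL : forall b x y, lower b -> Phi ((b * x)%g, y) = Hchar la b * Phi (x, y))
  (PhiR : forall b x y, upper b -> Phi (x, (b * y)%g) = Hchar (- nu) b * Phi (x, y))
  (PhiH : forall h x y, upper h ->
    Phi ((x * h)%g, (y * h)%g) = h 0 0 ^+ k * Phi (x, y))
  (Phi0 : exists g, Phi g != 0).

Definition psi (g : H) := Phi (g, g).

Lemma psi_right g h : upper h -> psi (g * h)%g = h 0 0 ^+ k * psi g.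
Proof. exact: PhiH. Qed.

Lemma psi_torus t g : lower t -> upper t -> psi (t * g)%g = Hchar (la - nu) t * psi g.
Proof.
move=> lt ut; rewrite /psi PhiL // PhiR // HcharD ?mulrA // => i.
exact: upper_diag_neq0.
Qed.

Definition psi_inv (p : H) := forall g, psi (g * p)%g = psi g.

Lemma psi_invM p q : psi_inv p -> psi_inv q -> psi_inv (p * q)%g.
Proof. by move=> hp hq g; rewrite mulgA hq hp. Qed.

(* The left-hand side is a polynomial in z, and in z^-1 because
   (1 0; z 1) = (z^-1 -1; 1 0) (z 1; 0 z^-1): hence it is constant. *)
Lemma psi_inv_plane (j i : 'I_n.+1) z : (0 < j)%N -> (j < i)%N ->
  psi_inv (toSL (plane j i 1 0 z 1)).
Proof.
move=> j0 ji g.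
have [P hP] : exists P : {poly C}, forall s,
    psi (g * toSL (plane j i 1 0 s 1))%g = P.[s].
  pose c s := (g * toSL (plane j i 1 0 s 1))%g.
  suff h : poly_curve c by have [P hP] := regG_poly_curve rPhi h h; exists P.
  apply: poly_curveM; first exact: poly_curve_const.
  have := @poly_curve_plane C n j i 1 0 'X 1 ji.
  rewrite mul0r subr0 mulr1 => /(_ erefl) h; move=> a b.
  by apply: subalg_ext (h a b) _ => s; rewrite !hornerC hornerX.
have [Q hQ] : exists Q : {poly C}, forall s,
    psi (g * toSL (plane j i s (-1) 1 0))%g = Q.[s].
  pose c s := (g * toSL (plane j i s (-1) 1 0))%g.
  suff h : poly_curve c by have [Q hQ] := regG_poly_curve rPhi h h; exists Q.
  apply: poly_curveM; first exact: poly_curve_const.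
  have := @poly_curve_plane C n j i 'X (-1) 1 0 ji.
  rewrite mulr0 mulr1 sub0r opprK => /(_ erefl) h; move=> a b.
  by apply: subalg_ext (h a b) _ => s; rewrite hornerX hornerN !hornerC.
have PQ s : s != 0 -> P.[s] = Q.[s^-1].
  move=> s0; rewrite -hP -hQ.
  have d1 : \det (plane j i s 1 0 s^-1) = 1 by rewrite det_plane_upper ?mulfV.
  have d2 : \det (plane j i s^-1 (-1) 1 0) = 1.
    by apply: det_plane => //; rewrite mulr0 mulr1 opprK add0r.
  have -> : toSL (plane j i 1 0 s 1) =
      (toSL (plane j i s^-1 (-1) 1 0) * toSL (plane j i s 1 0 s^-1))%g.
    rewrite -toSLM // planeM //; congr (toSL (plane j i _ _ _ _)); by field.
  rewrite mulgA psi_right; last first.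
    by rewrite /upper toSLE // tr_plane // plane_trig.
  have -> : toSL (plane j i s 1 0 s^-1) 0 0 = 1.
    have zj : (0 == j :> 'I_n.+1) = false by rewrite -val_eqE /=; lia.
    have zi : (0 == i :> 'I_n.+1) = false by rewrite -val_eqE /=; lia.
    by rewrite toSLE // plane_diag // zj zi.
  by rewrite expr1n mul1r.
rewrite hP (poly_inverse_const PQ) -hP plane1 //.
by have -> : toSL 1%:M = 1%g :> H; [apply: SL_inj; rewrite toSLE ?det1 | rewrite mulg1].
Qed.

Definition colmx (j : 'I_n.+1) (y : 'cV[C]_n.+1) : 'M[C]_n.+1 :=
  1%:M + y *m delta_mx 0 j.

Lemma colmxE j y r s : colmx j y r s = (r == s)%:R + (s == j)%:R * y r 0.
Proof.
rewrite !mxE (bigD1 0) //= big1 ?addr0 => [|t]; last by rewrite ord1.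
by rewrite !mxE eqxx /= mulrC.
Qed.

Definition below (j : 'I_n.+1) (y : 'cV[C]_n.+1) := forall i : 'I_n.+1, (i <= j)%N -> y i 0 = 0.

Lemma colmx_trig j y : below j y -> is_trig_mx (colmx j y).
Proof.
move=> by_; apply/is_trig_mxP => r s rs; rewrite colmxE -val_eqE ltn_eqF // add0r.
by case: eqP => [e|_]; rewrite ?mul0r // by_ ?mulr0 // -e ltnW.
Qed.

Lemma colmx_diag j y i : below j y -> colmx j y i i = 1.
Proof.
move=> by_; rewrite colmxE eqxx; case: eqP => [->|_]; rewrite ?mul0r ?addr0 //.
by rewrite by_ ?mulr0 ?addr0.
Qed.

Lemma det_colmx j y : below j y -> \det (colmx j y) = 1.
Proof.
by move=> by_; rewrite det_trig ?colmx_trig // big1 // => i _; rewrite colmx_diag.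
Qed.

Lemma mul_colmx j y (A : 'M[C]_n.+1) r s :
  (A *m colmx j y) r s = A r s + (s == j)%:R * (A *m y) r 0.
Proof.
rewrite /colmx mulmxDr mulmx1 mulmxA mxE; congr (_ + _).
rewrite mxE (bigD1 0) //= big1 ?addr0 => [|t]; last by rewrite ord1.
by rewrite [X in _ * X]mxE eqxx /= mulrC.
Qed.

Lemma colmxD j y y' : below j y -> below j y' ->
  colmx j (y + y') = colmx j y *m colmx j y'.
Proof.
move=> hy hy'; apply/matrixP => r s; rewrite mul_colmx !colmxE mxE mulrDr addrA.
congr (_ + _ * _); rewrite mulmxDl mul1mx mxE -mulmxA.
rewrite [X in _ + X](_ : _ = 0) ?addr0 //.
rewrite -rowE; apply: etrans (_ : (y *m (0 : 'M_1)) r 0 = 0); last by rewrite mulmx0 mxE.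
by congr ((y *m _) r 0); apply/matrixP => a b; rewrite !mxE !ord1 hy'.
Qed.

Lemma plane_colmx (j i : 'I_n.+1) z : (j < i)%N ->
  plane j i 1 0 z 1 = colmx j (z *: delta_mx i 0).
Proof.
move=> ij; apply/matrixP => r s; rewrite colmxE !mxE andbT.
have [rj|rj] := eqVneq r j.
  have ri : (r == i) = false by rewrite rj -val_eqE ltn_eqF.
  rewrite ri !mulr0 addr0 rj [j == s]eq_sym; case: (s == j) => //; by case: ifP.
have [ri|ri] := eqVneq r i.
  rewrite mulr1 ri; case: (eqVneq s j) => [->|sj].
    by rewrite (_ : (i == j) = false) ?add0r ?mul1r // -ri (negbTE rj).
  by rewrite mul0r addr0 [i == s]eq_sym; case: (s == i).
by rewrite !mulr0 addr0.
Qed.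

Lemma colmx_mul j y (A : 'M[C]_n.+1) r s :
  (colmx j y *m A) r s = A r s + y r 0 * A j s.
Proof.
rewrite /colmx mulmxDl mul1mx -mulmxA -rowE mxE; congr (_ + _).
rewrite mxE (bigD1 0) //= big1 ?addr0 => [|t]; last by rewrite ord1.
by rewrite [X in _ * X]mxE.
Qed.

(** [colmx j] turns sums into products, so it is a product of the elementary shears of
    [psi_inv_plane]. *)
Lemma psi_inv_colmx (j : 'I_n.+1) y : (0 < j)%N -> below j y -> psi_inv (toSL (colmx j y)).
Proof.
move=> j0 hy.
have inv1 : psi_inv (toSL (colmx j 0)).
  move=> g; rewrite (_ : toSL _ = 1%g) ?mulg1 //; apply: SL_inj.
  by rewrite toSLE /colmx mul0mx addr0 // det1.
have -> : y = \sum_(i < n.+1) y i 0 *: delta_mx i 0.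
  by rewrite {1}(matrix_sum_delta y); apply: eq_bigr => i _; rewrite big_ord1.
pose P (v : 'cV[C]_n.+1) := below j v /\ psi_inv (toSL (colmx j v)).
suff [] : P (\sum_(i < n.+1) y i 0 *: delta_mx i 0) by [].
apply: (big_ind P) => [|v v' [hv iv] [hv' iv']|i _].
- by split=> // i _; rewrite mxE.
- split; first by move=> i ij; rewrite mxE hv // hv' // addr0.
  rewrite colmxD // toSLM ?det_colmx //; exact: psi_invM.
- have [ij|ij] := leqP i j; first by rewrite hy // scale0r; split=> // i' _; rewrite mxE.
  split=> [i' ij'|].
    by rewrite !mxE (_ : (i' == i) = false) ?mulr0 // -val_eqE /= ltn_eqF // (leq_ltn_trans ij').
  by rewrite -plane_colmx //; apply: psi_inv_plane.
Qed.

(** [T t] keeps the first t columns of l, and each step multiplies on the right by one column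
    matrix. The first column being trivial, only columns of positive index enter. *)
Lemma psi_inv_lower l : lower l -> unip l -> (forall i : 'I_n.+1, (0 < i)%N -> l i 0 = 0) ->
  psi_inv l.
Proof.
move=> /is_trig_mxP ll l1 l0.
pose T t : 'M[C]_n.+1 := \matrix_(r, s) if (s < t)%N then l r s else (r == s)%:R.
have Tt t : is_trig_mx (T t).
  apply/is_trig_mxP => r s rs; rewrite mxE; case: ifP => _; first exact: ll.
  by rewrite -val_eqE ltn_eqF.
have T1 t i : T t i i = 1 by rewrite mxE eqxx l1 if_same.
have dT t : \det (T t) = 1 by rewrite det_trig // big1.
suff h t : (t <= n.+1)%N -> psi_inv (toSL (T t)).
  have <- : toSL (T n.+1) = l.
    by apply: SL_inj; rewrite toSLE //; apply/matrixP => r s; rewrite mxE ltn_ord.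
  exact: h.
elim: t => [_|t IH tn].
  have -> : T 0%N = 1%:M by apply/matrixP => r s; rewrite !mxE.
  move=> g; rewrite (_ : toSL _ = 1%g) ?mulg1 //; apply: SL_inj; by rewrite toSLE ?det1.
have [t0|t0] := posnP t.
  have -> : T t.+1 = T t; last by apply: IH; rewrite t0.
  apply/matrixP => r s; rewrite !mxE t0 ltn0 ltnS leqn0.
  case: eqP => // s0; have -> : s = 0 by apply: ord_inj.
  by have [->|r0] := eqVneq r 0; [exact: l1 | rewrite l0 // lt0n].
pose j : 'I_n.+1 := Ordinal tn.
pose y : 'cV[C]_n.+1 := \col_i (if (i <= j)%N then 0 else l i j).
have hy : below j y by move=> i ij; rewrite mxE ij.
have -> : T t.+1 = T t *m colmx j y.
  apply/matrixP => r s; rewrite mul_colmx.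
  have -> : (T t *m y) r 0 = y r 0.
    rewrite mxE (bigD1 r) //= big1 ?addr0 => [|a ar]; first by rewrite T1 mul1r.
    have [aj|aj] := leqP a j; first by rewrite (hy a aj) mulr0.
    by rewrite mxE ltnNge (ltnW aj) /= eq_sym (negbTE ar) mul0r.
  rewrite [T t.+1 r s]mxE [T t r s]mxE [y r 0]mxE ltnS (_ : (s == j) = (s == t :> nat)) //=.
  case: (ltngtP s t) => st; rewrite ?mul0r ?addr0 //.
  have sj : s = j by apply: ord_inj.
  rewrite mul1r sj /=; case: (ltngtP r t) => rt; rewrite ?add0r ?addr0.
  - by rewrite ll // -val_eqE ltn_eqF.
  - by rewrite -val_eqE gtn_eqF ?add0r.
  - have -> : r = j by apply: ord_inj.
    by rewrite eqxx l1.
rewrite toSLM ?det_colmx //; apply: psi_invM; first exact: IH (ltnW tn).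
exact: psi_inv_colmx.
Qed.

(** A representative in the group of the point (1 : x_1 : ... : x_n). *)
Definition gcol (x : 'I_n.+1 -> C) : H :=
  toSL (colmx 0 (\col_i (if i == 0 then 0 else x i))).

Lemma below_gcol (x : 'I_n.+1 -> C) : below 0 (\col_i (if i == 0 then 0 else x i)).
Proof.
move=> i; rewrite leqn0 mxE => i0.
by have -> : i = 0 by apply/ord_inj/eqP.
Qed.

Lemma gcolE x r s :
  gcol x r s = (r == s)%:R + (s == 0)%:R * (if r == 0 then 0 else x r).
Proof. by rewrite toSLE ?det_colmx ?colmxE ?mxE //; apply: below_gcol. Qed.

Lemma gcol_lower x : lower (gcol x).
Proof. by rewrite /lower toSLE ?det_colmx ?colmx_trig //; apply: below_gcol. Qed.

Lemma gcol_unip x : unip (gcol x).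
Proof. by move=> i; rewrite toSLE ?det_colmx ?colmx_diag //; apply: below_gcol. Qed.

(** Splitting off the first column of l leaves a factor that fixes e_1. *)
Lemma psi_lower l : lower l -> unip l -> psi l = psi (gcol (fun i => l i 0)).
Proof.
move=> ll l1; have /is_trig_mxP tl := ll.
pose M : 'M[C]_n.+1 := \matrix_(r, s) if s == 0 then (r == s)%:R else l r s.
have tM : is_trig_mx M.
  apply/is_trig_mxP => r s rs; rewrite mxE.
  by case: eqP => [s0|_]; [rewrite s0 in rs | exact: tl].
have M1 i : M i i = 1 by rewrite mxE l1 eqxx if_same.
have dM : \det M = 1 by rewrite det_trig // big1.
have e : l = (gcol (fun i => l i 0%R) * toSL M)%g.
  apply: SL_inj; rewrite slmxM !toSLE ?det_colmx //; last exact: below_gcol.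
  apply/matrixP => r s; rewrite /colmx mulmxDl mul1mx -mulmxA -rowE mxE.
  rewrite [X in _ = _ + X]mxE (bigD1 0) //= big1 ?addr0 => [|t]; last by rewrite ord1.
  rewrite !mxE; have [s0|s0] := eqVneq s 0.
    rewrite s0 mulr1; have [->|r0] := eqVneq r 0; first by rewrite l1 addr0.
    by rewrite add0r.
  rewrite (tl 0 s); last by rewrite lt0n.
  by rewrite mulr0 addr0.
rewrite {1}e psi_inv_lower //.
- by rewrite /lower toSLE.
- by move=> i; rewrite toSLE.
- move=> i i0; rewrite toSLE // mxE eqxx -val_eqE gtn_eqF //.
Qed.

(** Both sides are psi of t gcol(1) = gcol(t_i / t_0) t, computed by left and by right
    covariance. *)
Lemma psi_gcol (t : 'I_n.+1 -> C) : (forall i, t i != 0) -> \prod_i t i = 1 ->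
  t 0 ^+ k * psi (gcol (fun i => t i / t 0)) =
  Hchar (la - nu) (toSL (diag_mx (\row_i t i))) * psi (gcol (fun=> 1)).
Proof.
move=> t0 pt; set T := toSL _.
have dT : \det (diag_mx (\row_i t i)) = 1.
  by rewrite det_diag -[RHS]pt; apply: eq_bigr => i _; rewrite mxE.
have TE : T = diag_mx (\row_i t i) :> 'M_n.+1 by rewrite toSLE.
have lT : lower T by rewrite /lower TE diag_mx_is_trig.
have uT : upper T by rewrite /upper TE tr_diag_mx diag_mx_is_trig.
have T00 : T 0 0 = t 0 by rewrite TE !mxE eqxx mulr1n.
rewrite -psi_torus // -T00 -psi_right //; congr psi; apply: SL_inj.
rewrite !slmxM TE; apply/matrixP => r s.
rewrite mul_diag_mx mul_mx_diag [LHS]mxE [RHS]mxE !gcolE !mxE eqxx mulr1n.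
rewrite mulrDl mulrDr; congr (_ + _).
  by have [->|_] := eqVneq r s; rewrite ?mulr0 ?mul0r // mulrC.
have [->|_] := eqVneq s 0; last by rewrite !mul0r mulr0.
by rewrite !mul1r; case: ifP => _; rewrite ?mul0r ?mulr0 // mulr1 mulfVK.
Qed.

(** A general element is v times an upper matrix, with v lower unipotent and without zero in its
    first column; such a column lies in the torus orbit of (1, ..., 1) up to scaling. *)
Lemma psi_eq0 : psi (gcol (fun=> 1)) = 0 -> forall g, psi g = 0.
Proof.
move=> z g; apply/eqP/negPn/negP => pg.
have hs := regular_subalg (@Gcoord C n).
have r1 : regG (fun g : G => psi g.1).
  by apply: (@regG_subst C n G _ _ (fun g : G => (g.1, g.1)) hs rPhi) => i j; apply: regG_fst.
have r2 : regG (fun g : G => trailing_minors (g.1^-1)%g).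
  apply: subalg_trailing_minors => // i j.
  apply: subalg_ext (subalg_adj hs (@regG_fst C n) i j) _ => x.
  by rewrite -slmxV_adj.
have r3 : regG (fun g : G => \prod_i g.1 i 0).
  by apply: subalg_prod => // i _; apply: regG_fst.
have [||h [h2 h3]] := @regG_mul_neq0 C n _ _ (1%g, 1%g) (gcol (fun=> 1), 1%g) r2 r3.
- rewrite -[_ != 0]/(trailing_minors ((1 : H)^-1)%g != 0).
  by rewrite invg1 slmx1 trailing_minors1 oner_neq0.
- apply/prodf_neq0 => i _; rewrite gcolE eqxx mul1r.
  by case: (i == 0); rewrite ?addr0 ?add0r; apply: oner_neq0.
have [|h' []] := @regG_mul_neq0 C n _ _ (g, 1%g) h r1 (subalg_mul hs r2 r3) pg.
  by rewrite mulf_neq0.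
move: (h'.1) => x px; rewrite mulf_eq0 negb_or => /andP[/SL_UL[u [l [e uu u1 ll]]] /prodf_neq0 x0].
have ex : x = (l^-1 * u^-1)%g by rewrite -invgM -e invgK.
have [v [t [el lv v1 ut tE]]] := lower_decomp (lowerV ll).
have ex' : x = (v * (t * u^-1))%g by rewrite ex el mulgA.
have ub : upper (t * u^-1)%g by apply: upperM => //; apply: upperV.
have v0 i : v i 0 != 0.
  have := x0 i isT; apply: contraNneq => vi; rewrite ex' slmxM mxE big1 // => a _.
  have [->|a0] := eqVneq a 0; first by rewrite vi mul0r.
  by move/upperP: ub => ->; rewrite ?mulr0 // lt0n.
move: px; rewrite ex' psi_right // psi_lower //.
(* The scalar that gives the torus element with entries c v_i determinant 1. *)
have [c hc] := exists_root (\prod_(i < n.+1) v i 0)^-1 (ltn0Sn n).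
have c0 : c != 0.
  have : c ^+ n.+1 != 0 by rewrite hc invr_neq0 //; apply/prodf_neq0.
  by rewrite expf_eq0.
have h1 : v 0 0 = 1 by [].
have := @psi_gcol (fun i => c * v i 0) _ _.
rewrite z mulr0 h1 mulr1 => /(_ _ _)/eqP; rewrite mulf_eq0 expf_eq0 (negbTE c0) andbF /=.
move=> H0; have {H0} /eqP : psi (gcol (fun i => c * v i 0 / c)) == 0.
  apply: H0 => [i|]; first by rewrite mulf_neq0.
  by rewrite big_split /= prodr_const card_ord hc mulVf //; apply/prodf_neq0.
under [X in gcol X]eq_fun => i do rewrite mulrAC mulfV // mul1r.
by move=> ->; rewrite mulr0 eqxx.
Qed.

(** For y x^-1 = u l the value of Phi at (x, y) is a multiple of psi (l x), so psi is not
    identically 0. *)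
Lemma psi1_neq0 : psi (gcol (fun=> 1)) != 0.
Proof.
apply/eqP => /psi_eq0 z; have [g Pg] := Phi0.
have hs := regular_subalg (@Gcoord C n).
have r2 : regG (fun g : G => trailing_minors (g.2 * g.1^-1)%g).
  apply: subalg_trailing_minors => // i j; apply: subalg_mulmx => // a b.
    exact: regG_snd.
  apply: subalg_ext (subalg_adj hs (@regG_fst C n) a b) _ => x.
  by rewrite -slmxV_adj.
have [|[x y] [Pxy /SL_UL[u [l [e uu u1 ll]]]]] := @regG_mul_neq0 C n _ _ g 1%g rPhi r2 Pg.
  rewrite -[_ != 0]/(trailing_minors ((1 : H) * 1^-1)%g != 0).
  by rewrite invg1 mulg1 slmx1 trailing_minors1 oner_neq0.
move: Pxy; have -> : y = (u * (l * x))%g by rewrite mulgA -e mulgVK.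
rewrite PhiR // -{1}(mulKg l x) PhiL; last exact: lowerV.
by rewrite [Phi _]z !mulr0 eqxx.
Qed.

Lemma gcol_ext x x' : (forall i, i != 0 -> x i = x' i) -> gcol x = gcol x'.
Proof.
move=> h; apply: SL_inj; apply/matrixP => r s; rewrite !gcolE.
by case: ifP => // /negbT /h ->.
Qed.

Lemma exprz_sum (c : C) (I : Type) (r : seq I) (P : pred I) (F : I -> int) :
  c != 0 -> \prod_(i <- r | P i) c ^ F i = c ^ (\sum_(i <- r | P i) F i).
Proof.
move=> c0; symmetry; apply: (big_morph (fun e => c ^ e)) => [a b|].
  by rewrite expfzDr.
exact: expr0z.
Qed.

Definition wt (j : 'I_n) : int := (la - nu) 0 j.

(** n + 1 times the exponent of x_i in the monomial: [torus_elt c i] has determinant 1 and scales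
    x_i against the other coordinates by c^(n+1). *)
Definition orbit_exp (i : 'I_n.+1) : int :=
  k%:Z - \sum_(j < n) (j.+1)%:Z * wt j + n.+1%:Z * \sum_(j < n | (i <= j)%N) wt j.

Definition torus_elt (c : C) (i r : 'I_n.+1) : C := if r == i then c ^+ n else c^-1.

Lemma prod_torus_elt c (i : 'I_n.+1) m : c != 0 -> (m <= n.+1)%N ->
  \prod_(r < n.+1 | (r < m)%N) torus_elt c i r =
  c ^ (- m%:Z + (if (i < m)%N then n.+1%:Z else 0)).
Proof.
move=> c0 mn.
have -> : \prod_(r < n.+1 | (r < m)%N) torus_elt c i r =
    \prod_(r < n.+1 | (r < m)%N) (c^-1 * (if r == i then c ^+ n.+1 else 1)).
  apply: eq_bigr => r _; rewrite /torus_elt; case: eqP => _; rewrite ?mulr1 //.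
  by rewrite exprS mulKf.
rewrite big_split /= -(big_ord_widen n.+1 (fun=> c^-1)) // prodr_const card_ord.
rewrite expfzDr // exprVn; congr (_ * _); first by rewrite exprnN.
case: (boolP (i < m)%N) => im.
  rewrite (bigD1 i) //= eqxx big1 ?mulr1 // => r /andP[_ ri].
  by rewrite (negbTE ri).
by rewrite big1 // => r rm; case: eqP => // e; rewrite -e rm in im.
Qed.

Lemma Hchar_torus_elt c (i : 'I_n.+1) : c != 0 ->
  Hchar (la - nu) (toSL (diag_mx (\row_r torus_elt c i r))) = c ^ (orbit_exp i - k%:Z).
Proof.
move=> c0.
have dT : \det (diag_mx (\row_r torus_elt c i r)) = 1.
  rewrite det_diag; transitivity (\prod_(r < n.+1 | (r < n.+1)%N) torus_elt c i r).
    by apply: eq_big => [r|r _]; rewrite ?ltn_ord ?mxE.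
  by rewrite prod_torus_elt // ltn_ord addNr expr0z.
have -> : orbit_exp i - k%:Z =
    \sum_(j < n) (- (j.+1)%:Z + (if (i < j.+1)%N then n.+1%:Z else 0)) * wt j.
  under [RHS]eq_bigr => j _ do rewrite mulrDl mulNr.
  rewrite big_split /= sumrN /orbit_exp addrAC [k%:Z - _]addrC addrK; congr (_ + _).
  rewrite mulr_sumr big_mkcond /=; apply: eq_bigr => j _.
  by rewrite ltnS; case: ifP; rewrite ?mul0r.
rewrite -exprz_sum // /Hchar; apply: eq_bigr => j _.
rewrite -exprz_exp -prod_torus_elt //; last by rewrite ltnS ltnW.
congr (_ ^ _); apply: eq_big => [r|r _]; first by rewrite ltnS.
by rewrite toSLE // !mxE eqxx.
Qed.

Lemma psi_torus_elt c (i : 'I_n.+1) : c != 0 ->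
  torus_elt c i 0 ^+ k * psi (gcol (fun r => torus_elt c i r / torus_elt c i 0)) =
  c ^ (orbit_exp i - k%:Z) * psi (gcol (fun=> 1)).
Proof.
move=> c0; rewrite psi_gcol ?Hchar_torus_elt // => [r|].
  by rewrite /torus_elt; case: ifP => _; rewrite ?expf_neq0 ?invr_neq0.
transitivity (\prod_(r < n.+1 | (r < n.+1)%N) torus_elt c i r).
  by apply: eq_bigl => r; rewrite ltn_ord.
by rewrite prod_torus_elt // ltn_ord addNr expr0z.
Qed.

Lemma expz_shift (c : C) (e : int) : c != 0 -> c ^ e = c ^+ k * c ^ (e - k%:Z).
Proof. by move=> c0; rewrite exprnP -expfzDr // addrC subrK. Qed.

Lemma psi_coord c (i : 'I_n.+1) : c != 0 -> i != 0 ->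
  psi (gcol (fun r => if r == i then c ^+ n.+1 else 1)) =
  c ^ orbit_exp i * psi (gcol (fun=> 1)).
Proof.
move=> c0 i0; have := psi_torus_elt i c0.
have t0 : torus_elt c i 0 = c^-1 by rewrite /torus_elt eq_sym (negbTE i0).
rewrite t0 (_ : gcol _ = gcol (fun r => if r == i then c ^+ n.+1 else 1)); last first.
  apply: gcol_ext => r _; rewrite /torus_elt invrK; case: ifP => _.
    by rewrite exprSr.
  by rewrite mulVf.
move=> h; rewrite (expz_shift _ c0) -mulrA -h mulrA -exprMn mulfV //.
by rewrite expr1n mul1r.
Qed.

Lemma psi_coord0 c : c != 0 ->
  (c ^+ n.+1) ^+ k * psi (gcol (fun=> (c ^+ n.+1)^-1)) =
  c ^ orbit_exp 0 * psi (gcol (fun=> 1)).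
Proof.
move=> c0; have := psi_torus_elt 0 c0.
have t0 : torus_elt c 0 0 = c ^+ n by rewrite /torus_elt eqxx.
rewrite t0 (_ : gcol _ = gcol (fun=> (c ^+ n.+1)^-1)); last first.
  by apply: gcol_ext => r r0; rewrite /torus_elt (negbTE r0) exprS invfM.
move=> h; rewrite (expz_shift _ c0) -mulrA -h mulrA exprS exprMn.
by [].
Qed.

Lemma ord0_lt_max : ((ord0 : 'I_n.+1) < (ord_max : 'I_n.+1))%N. Proof. exact: n_gt0. Qed.

(** The plane factor of [first_col] has first column s e_1 + e_(n+1); placing this vector in the
    last column fills the remaining entries with 1. *)
Definition mid_col : 'cV[C]_n.+1 := \col_i (if (0 < i < n)%N then 1 else 0).

Lemma mid_colmx_upper : is_trig_mx (colmx ord_max mid_col)^T.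
Proof.
apply/is_trig_mxP => r s rs; rewrite mxE colmxE -val_eqE /= gtn_eqF // add0r mxE.
case: eqP => [e|_]; last by rewrite mul0r.
have := ltn_ord s; rewrite e /= in rs; lia.
Qed.

Lemma mid_colmx_diag i : colmx ord_max mid_col i i = 1.
Proof.
rewrite colmxE eqxx mxE; case: eqP => [->|_]; last by rewrite mul0r addr0.
by rewrite /= ltnn andbF mulr0 addr0.
Qed.

Lemma det_mid_colmx : \det (colmx ord_max mid_col) = 1.
Proof.
rewrite -det_tr det_trig ?mid_colmx_upper // big1 // => i _.
by rewrite mxE mid_colmx_diag.
Qed.

(* A matrix with first column (s, 1, ..., 1), polynomial in s. *)
Definition first_col (s : C) : H :=
  (toSL (colmx ord_max mid_col) * toSL (plane ord0 ord_max s (-1) 1 0)%R)%g.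

Lemma psi_first_col s : s != 0 ->
  psi (first_col s) = s ^+ k * psi (gcol (fun=> s^-1)).
Proof.
move=> s0; have n0 := ord0_lt_max.
have d1 : \det (plane ord0 (ord_max : 'I_n.+1) s (-1) 0 s^-1) = 1.
  by rewrite det_plane_upper ?mulfV.
have d2 : \det (plane ord0 (ord_max : 'I_n.+1) s (-1) 1 0) = 1.
  by apply: det_plane => //; rewrite mulr0 mulr1 opprK add0r.
have uU : upper (toSL (colmx ord_max mid_col)).
  by rewrite /upper toSLE ?det_mid_colmx // mid_colmx_upper.
have uP : upper (toSL (plane ord0 (ord_max : 'I_n.+1) s (-1) 0 s^-1)).
  by rewrite /upper toSLE // tr_plane // plane_trig.
have -> : first_col s = (gcol (fun=> s^-1)%R * (toSL (colmx ord_max mid_col) *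
    toSL (plane ord0 ord_max s (-1) 0 s^-1)%R))%g.
  apply: SL_inj; rewrite /first_col !slmxM !toSLE ?det_mid_colmx ?det_colmx //;
    last exact: below_gcol.
  have -> : plane ord0 (ord_max : 'I_n.+1) s (-1) 1 0 =
      plane ord0 ord_max 1 0 s^-1 1 *m plane ord0 ord_max s (-1) 0 s^-1.
    by rewrite planeM //; congr plane; field.
  rewrite !mulmxA; congr (_ *m _); rewrite plane_colmx //.
  apply/matrixP => r c; rewrite mul_colmx colmx_mul; congr (_ + _).
  rewrite -scalemxAr -colE mxE [X in s^-1 * X]mxE !colmxE eqxx mul1r.
  rewrite [mid_col 0 0]mxE ltnn mulr0 addr0 [(\col_i _) r 0]mxE [0 == c]eq_sym mulrC.
  congr (_ * _); rewrite mxE -!val_eqE /=; have := ltn_ord r.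
  case: (ltngtP r n) => rn; case: (posnP r) => r0 //=; rewrite ?mulr0 ?addr0 ?add0r ?mulr1 // => rn';
    rewrite ?mulr0 //; exfalso; move: n_gt0; lia.
rewrite psi_right; last exact: upperM.
rewrite upperM_diag // !toSLE ?det_mid_colmx // mid_colmx_diag mul1r.
by rewrite plane_diag // eqxx.
Qed.

(** The polynomial is evaluated at c^(n+1), so nonnegativity and divisibility by n + 1 come out
    together. The coordinate i = 0 needs its own curve, since [gcol] has x_0 = 1. *)
Lemma orbit_exp_nat (i : 'I_n.+1) : exists e : nat, orbit_exp i = (n.+1 * e)%N.
Proof.
have [i0|i0] := eqVneq i 0.
  have [P hP] : exists P : {poly C}, forall s, psi (first_col s) = P.[s].
    suff h : poly_curve first_col by have [P hP] := regG_poly_curve rPhi h h; exists P.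
    apply: poly_curveM; first exact: poly_curve_const.
    have := @poly_curve_plane C n ord0 ord_max 'X (-1) 1 0 ord0_lt_max.
    rewrite mulr0 mulr1 sub0r opprK => /(_ erefl) h; move=> a b.
    by apply: subalg_ext (h a b) _ => s; rewrite hornerX hornerN !hornerC.
  apply: (monomial_exponent (P := P) (ltn0Sn n) psi1_neq0) => c c0.
  by rewrite -hP psi_first_col ?expf_neq0 // psi_coord0 // i0.
have [P hP] : exists P : {poly C}, forall s,
    psi (gcol (fun r => if r == i then s else 1)) = P.[s].
  pose c s := gcol (fun r => if r == i then s else 1).
  suff h : poly_curve c by have [P hP] := regG_poly_curve rPhi h h; exists P.
  move=> r t.
  pose q : {poly C} := if r == i then 'X else 1.
  exists ((r == t)%:R%:P + (t == 0)%:R%:P * (if r == 0 then 0 else q)), 0%N => s _.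
  rewrite expr0 mul1r gcolE hornerD hornerM !hornerC; congr (_ + _ * _).
  by rewrite /q; case: ifP => _; rewrite ?horner0 //; case: ifP => _; rewrite ?hornerX ?hornerC.
apply: (monomial_exponent (P := P) (ltn0Sn n) psi1_neq0) => c c0.
by rewrite -hP psi_coord.
Qed.

Lemma psi_coord_nat (i : 'I_n.+1) (e : nat) s : orbit_exp i = (n.+1 * e)%N ->
  s != 0 -> i != 0 ->
  psi (gcol (fun r => if r == i then s else 1)) = s ^+ e * psi (gcol (fun=> 1)).
Proof.
move=> he s0 i0; have [c hc] := exists_root s (ltn0Sn n).
have c0 : c != 0 by move: s0; rewrite -hc expf_eq0.
by rewrite -hc psi_coord // he -exprnP exprM.
Qed.

(** With [node1], the two coordinates exchanged by the j-th simple reflection. *)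
Definition node0 (j : 'I_n) : 'I_n.+1 := widen_ord (leqnSn n) j.
Definition node1 (j : 'I_n) : 'I_n.+1 := lift ord0 j.

Lemma node01 (j : 'I_n) : (node0 j < node1 j)%N.
Proof. by rewrite /= /bump leq0n add1n. Qed.

Lemma orbit_expB (j : 'I_n) : orbit_exp (node0 j) - orbit_exp (node1 j) = n.+1%:Z * wt j.
Proof.
rewrite /orbit_exp opprD addrACA subrr add0r -mulrBr; congr (_ * _).
rewrite (bigD1 j) //= [X in _ + X - _](eq_bigl (fun i : 'I_n => (node1 j <= i)%N)).
  by rewrite addrK.
by move=> i; rewrite /= /bump leq0n add1n ltn_neqAle andbC eq_sym.
Qed.

(** Homogeneity of degree k: among the tail sums, each [wt j] is counted j + 1 times and cancels. *)
Lemma sum_orbit_exp : \sum_i orbit_exp i = n.+1%:Z * k%:Z.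
Proof.
rewrite /orbit_exp big_split /= sumr_const card_ord -mulr_sumr.
rewrite (exchange_big_dep xpredT) //=.
have -> : \sum_(j < n) \sum_(i < n.+1 | (i <= j)%N) wt j = \sum_(j < n) (j.+1)%:Z * wt j.
  apply: eq_bigr => j _; rewrite sumr_const.
  have -> : #|[pred i : 'I_n.+1 | (i <= j)%N]| = j.+1.
    rewrite -sum1_card; transitivity (\sum_(i < j.+1) 1)%N.
      by rewrite (big_ord_widen n.+1 (fun=> 1%N)) // ltnS ltnW.
    by rewrite sum_nat_const card_ord muln1.
  by rewrite -mulr_natl natz.
by rewrite -[X in X + _]mulr_natl natz -mulrDr subrK.
Qed.

Lemma Hchar_plane (a : SLweight n) (j : 'I_n) (d b : C) : d != 0 ->
  Hchar a (toSL (plane (node0 j) (node1 j) d^-1 b 0 d)) = d ^ (- a 0 j).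
Proof.
move=> d0; have nj := node01 j.
have dg (r : 'I_n.+1) : toSL (plane (node0 j) (node1 j) d^-1 b 0 d) r r =
    if (r : nat) == j then d^-1 else if (r : nat) == j.+1 then d else 1.
  by rewrite toSLE ?det_plane_upper ?mulVf // plane_diag.
rewrite /Hchar (bigD1 j) //= [X in _ * X]big1 ?mulr1 => [|j' jj'].
  rewrite (bigD1 (node0 j)) /= ?leqnn // big1 => [|r /andP[rj r0]].
    by rewrite dg eqxx mulr1 exprz_inv.
  have rj' : ((r : nat) == j) = false by apply: negbTE; rewrite -val_eqE in r0.
  by rewrite dg rj' (_ : ((r : nat) == j.+1) = false) // ltn_eqF.
have [lt|ge] := ltnP j' j.
  rewrite big1 ?exp1rz // => r rj; rewrite dg.
  by rewrite !ltn_eqF // ?ltnS ?(leq_trans rj (ltnW lt)) ?(leq_ltn_trans rj lt).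
have {}ge : (j < j')%N by rewrite ltn_neqAle ge andbT eq_sym.
rewrite (bigD1 (node0 j)) /= ?(ltnW ge) // (bigD1 (node1 j)) /=; last first.
  by rewrite -val_eqE /= /bump leq0n add1n ge gtn_eqF.
rewrite big1 ?mulr1 => [|r /andP[/andP[_ r0] r1]].
  by rewrite !dg /= eqxx /bump leq0n add1n eqxx gtn_eqF // mulVf // exp1rz.
have rj0 : ((r : nat) == j) = false by apply: negbTE; rewrite -val_eqE in r0.
have rj1 : ((r : nat) == j.+1) = false.
  by apply: negbTE; rewrite -val_eqE /= /bump leq0n add1n in r1.
by rewrite dg rj0 rj1.
Qed.

(* d |-> Phi (g1, y(d) g1), y(d) = (0 -1; 1 d) in the plane j, j+1, is a
   polynomial which equals d^(nu_j) (1 + 1/d)^e up to a constant. *)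
Lemma orbit_exp_le (j : 'I_n) (e : nat) : orbit_exp (node1 j) = (n.+1 * e)%N ->
  e%:Z <= nu 0 j.
Proof.
move=> he; rewrite leNgt; apply/negP => lt.
have nj := node01 j.
pose g1 := gcol (fun=> 1).
have [P hP] : exists P : {poly C}, forall d,
    Phi (g1, toSL (plane (node0 j) (node1 j) 0 (-1) 1 d) * g1)%g = P.[d].
  apply: regG_poly_curve => //; first exact: poly_curve_const.
  apply: poly_curveM; last exact: poly_curve_const.
  have := @poly_curve_plane C n (node0 j) (node1 j) 0 (-1) 1 'X nj.
  rewrite mul0r mulr1 sub0r opprK => /(_ erefl) h; move=> a b.
  by apply: subalg_ext (h a b) _ => s; rewrite hornerX hornerN !hornerC.
have val d : d != 0 -> d != -1 -> P.[d] = d ^ (nu 0 j) * ((1 + d^-1) ^+ e * psi g1).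
  move=> d0 d1; rewrite -hP.
  pose B := toSL (plane (node0 j) (node1 j) d^-1 (-1) 0 d).
  pose X := toSL (plane (node0 j) (node1 j) 1 0 d^-1 1).
  have dB : \det (plane (node0 j) (node1 j) d^-1 (-1) 0 d) = 1.
    by rewrite det_plane_upper ?mulVf.
  have dX : \det (plane (node0 j) (node1 j) 1 0 d^-1 1) = 1.
    by rewrite det_plane_lower ?mulr1.
  have lX : lower X by rewrite /lower toSLE // plane_trig.
  have X1 : unip X.
    by move=> r; rewrite toSLE // plane_diag //; case: (r == _); case: (r == _).
  have -> : toSL (plane (node0 j) (node1 j) 0 (-1) 1 d) = (B * X)%g.
    by rewrite -toSLM // planeM //; congr (toSL (plane _ _ _ _ _ _)); field.
  rewrite -mulgA PhiR; last by rewrite /upper toSLE // tr_plane // plane_trig.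
  rewrite Hchar_plane // mxE opprK; congr (_ * _).
  have -> : Phi (g1, (X * g1)%g) = psi (X * g1)%g.
    by rewrite /psi PhiL // Hchar_unip // mul1r.
  (* The first column of X g1 is (1, ..., 1) with 1 + 1/d at [node1 j]. *)
  rewrite psi_lower; last 2 first.
  - by apply: lowerM => //; apply: gcol_lower.
  - by move=> r; rewrite lowerM_diag ?gcol_unip ?X1 ?mulr1 //; apply: gcol_lower.
  rewrite -(psi_coord_nat he).
  - congr psi; apply: gcol_ext => r r0.
    rewrite slmxM toSLE // plane_colmx // colmx_mul !gcolE !mxE eqxx !mul1r (negbTE r0) add0r.
    have -> : (node0 j == 0)%:R + (if node0 j == 0 then 0 else 1) = 1 :> C.
      by case: (node0 j == 0); rewrite ?addr0 ?add0r.
    by rewrite eqxx andbT mulr1; case: (r == node1 j); rewrite ?mulr1 ?mulr0 ?addr0.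
  - apply: contraNneq d1 => h; rewrite -[d]invrK (_ : d^-1 = -1) ?invrN1 //.
    by apply/eqP; rewrite -subr_eq0 opprK addrC h.
  - by rewrite -val_eqE.
have [p hp] : exists p : nat, e%:Z = nu 0 j + p.+1%:Z.
  exists (absz (e%:Z - nu 0 j)%R).-1; lia.
(* The extra factor X + 1 covers d = -1, where [val] does not apply. At 0 the left side vanishes and
   the right side is psi g1. *)
have id : ('X + 1) * ('X^(p.+1) * P) = ('X + 1) ^+ e.+1 * (psi g1)%:P.
  apply: poly_eq_ext => d d0; rewrite !hornerE /=.
  have [->|d1] := eqVneq d (-1); first by rewrite addNr mul0r exprS !mul0r.
  rewrite val // [(d + 1) ^+ e.+1]exprS -!mulrA; congr (_ * _); rewrite !mulrA; congr (_ * _).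
  have -> : d ^+ p.+1 * d ^ nu 0 j = d ^+ e.
    by rewrite exprnP -expfzDr // addrC -hp.
  by rewrite -exprMn mulrDr mulr1 mulfV.
have := congr1 (fun q : {poly C} => q.[0]) id.
have -> : (('X + 1) * ('X^(p.+1) * P)).[0] = 0.
  by rewrite !hornerM hornerXn expr0n mul0r mulr0.
rewrite hornerM horner_exp hornerD hornerX !hornerC add0r expr1n mul1r => /esym/eqP.
by rewrite (negbTE psi1_neq0).
Qed.

Lemma open_orbit_exponents : exists e : 'I_n.+1 -> nat,
  [/\ (\sum_i e i)%N = k,
      forall j, (la - nu) 0 j = (e (node0 j))%:Z - (e (node1 j))%:Z
    & forall j, (e (node1 j))%:Z <= nu 0 j].
Proof.
have [e he] := fin_all_exists orbit_exp_nat.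
have n0 : n.+1%:Z != 0 by [].
exists e; split.
- have := sum_orbit_exp; rewrite (eq_bigr (fun i => n.+1%:Z * (e i)%:Z)); last first.
    by move=> i _; rewrite he PoszM.
  rewrite -mulr_sumr => /(mulfI n0) h; apply/eqP; rewrite -eqz_nat -h.
  by rewrite -(big_morph Posz PoszD (erefl 0%:Z)).
- move=> j; apply: (mulfI n0); rewrite -[(la - nu) 0 j]/(wt j) -orbit_expB !he.
  by rewrite !PoszM mulrBr.
- by move=> j; apply: orbit_exp_le.
Qed.

End OpenOrbit.

(** * The longest Weyl group element and its action on weights *)

Section Reversal.
Variables (C : numClosedFieldType) (n : nat).
Local Notation H := (SL C n.+1).

Definition rev_SL : H := toSL (det_normalize (perm_mx (perm (@rev_ord_inj n.+1)))).

Lemma rev_SLE : exists c : 'I_n.+1 -> C, (forall a, c a != 0) /\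
  forall a b, rev_SL a b = c a * (rev_ord a == b)%:R.
Proof.
rewrite /rev_SL; set s := perm _.
have d0 : \det (perm_mx s : 'M[C]_n.+1) != 0 by rewrite det_perm signr_eq0.
exists (fun a => if a == 0 then (\det (perm_mx s))^-1 else 1); split.
  by move=> a; case: ifP => _; rewrite ?invr_neq0 ?oner_neq0.
by move=> a b; rewrite toSLE ?det_det_normalize // det_normalizeE !mxE permE.
Qed.

Lemma rev_conjE (b : H) : exists c : 'I_n.+1 -> C, (forall a, c a != 0) /\
  forall i j, (rev_SL * b * rev_SL^-1)%g i j = c i / c j * b (rev_ord i) (rev_ord j).
Proof.
have [c [c0 hc]] := rev_SLE; exists c; split=> // i j.
set b' := (_ * _ * _)%g; apply: (mulIf (c0 j)).
have e : (b' * rev_SL = rev_SL * b)%g by rewrite /b' mulgVK.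
have /matrixP/(_ i (rev_ord j)) := congr1 (@slmx _ _) e.
rewrite !slmxM mxE (bigD1 j) //= hc eqxx mulr1 big1 ?addr0 => [->|a aj].
  rewrite mxE (bigD1 (rev_ord i)) //= hc eqxx mulr1 big1 ?addr0 => [|a ai].
    by rewrite mulrAC divfK.
  by rewrite hc eq_sym (negbTE ai) mulr0 mul0r.
by rewrite hc (inj_eq rev_ord_inj) (negbTE aj) !mulr0.
Qed.

Lemma rev_conj_lower (b : H) : upper b -> lower (rev_SL * b * rev_SL^-1)%g.
Proof.
move=> /upperP ub; have [c [c0 hc]] := rev_conjE b; apply/is_trig_mxP => i j ij.
by rewrite hc ub ?mulr0 //=; have := ltn_ord j; lia.
Qed.

Lemma rev_conj_diag (b : H) i :
  (rev_SL * b * rev_SL^-1)%g i i = b (rev_ord i) (rev_ord i).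
Proof. by have [c [c0 ->]] := rev_conjE b; rewrite divff ?mul1r. Qed.

(** As the determinant is 1, the product of the last diagonal entries inverts that of the first
    ones, so omega_j becomes -omega_(n+1-j). *)
Lemma Hchar_rev (a : SLweight n) (b : H) : upper b ->
  Hchar a (rev_SL * b * rev_SL^-1)%g = Hchar (- (\row_j a 0 (rev_ord j))) b.
Proof.
move=> ub; rewrite /Hchar (reindex_inj rev_ord_inj) /=; apply: eq_bigr => j _.
rewrite !mxE -exprz_inv; congr (_ ^ _).
under eq_bigr => r _ do rewrite rev_conj_diag.
rewrite (reindex_inj rev_ord_inj) /=.
under eq_bigr => r _ do rewrite rev_ordK.
have p0 : \prod_(i < n.+1 | (i <= j)%N) b i i != 0.
  by apply/prodf_neq0 => i _; apply: upper_diag_neq0.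
apply: (mulfI p0); rewrite mulfV //.
transitivity (\det b); last exact: det_slmx.
rewrite -det_tr det_trig //.
rewrite [RHS](bigID (fun r : 'I_n.+1 => (r <= j)%N)) /=; congr (_ * _).
  by apply: eq_bigr => r _; rewrite mxE.
apply: eq_big => [r|r _]; last by rewrite mxE.
by have := ltn_ord r; have := ltn_ord j; lia.
Qed.

Lemma HcharMn (a : SLweight n) k (b : H) : (forall i, b i i != 0) ->
  Hchar (a *+ k) b = Hchar a b ^+ k.
Proof.
move=> b0; elim: k => [|k IH]; first by rewrite mulr0n Hchar0.
by rewrite mulrS HcharD // IH exprS.
Qed.

End Reversal.

(** * The semigroup of pairs and the decomposition of weights *)

Section WeightSemigroup.
Variables (C : numClosedFieldType) (n : nat).
Local Notation H := (SL C n.+1).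
Local Notation G := (H * H)%type.

Definition spherical_pair (l : Gweight n) (mu : SLweight n) : Prop :=
  exists F : G -> C, spherical l mu F.

Lemma spherical_pair0 : spherical_pair 0 0.
Proof.
exists (fun=> 1); split.
- by apply: subalg_const; apply: regular_subalg.
- by exists 1%g; apply: oner_neq0.
- by move=> b g _; rewrite /Gchar !Hchar0 !mulr1.
- by move=> b g _; rewrite Hchar0 mulr1.
Qed.

Lemma spherical_pairD l l' mu mu' : spherical_pair l mu -> spherical_pair l' mu' ->
  spherical_pair (l + l') (mu + mu').
Proof. by move=> [F hF] [F' hF']; exists (fun g => F g * F' g); apply: sphericalM. Qed.

Lemma spherical_pairMn l mu k : spherical_pair l mu ->
  spherical_pair (l *+ k) (mu *+ k).
Proof.
move=> h; elim: k => [|k IH]; first exact: spherical_pair0.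
by rewrite !mulrS; apply: spherical_pairD.
Qed.

Lemma spherical_pair_sum (I : eqType) (r : seq I) (L : I -> Gweight n) (M : I -> SLweight n) :
  (forall i, i \in r -> spherical_pair (L i) (M i)) ->
  spherical_pair (\sum_(i <- r) L i) (\sum_(i <- r) M i).
Proof.
elim: r => [|i r IH] h; first by rewrite !big_nil; apply: spherical_pair0.
rewrite !big_cons; apply: spherical_pairD; first by apply: h; rewrite mem_head.
by apply: IH => j jr; apply: h; rewrite in_cons jr orbT.
Qed.

Lemma GdominantD (l l' : Gweight n) : Gdominant l -> Gdominant l' -> Gdominant (l + l').
Proof.
by move=> [h1 h2] [h1' h2']; split=> j; rewrite mxE addr_ge0 // ?h1 ?h2 ?h1' ?h2'.
Qed.

Lemma Gdominant0 : Gdominant (0 : Gweight n).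
Proof. by split=> j; rewrite mxE. Qed.

Lemma GdominantMn (l : Gweight n) k : Gdominant l -> Gdominant (l *+ k).
Proof.
move=> h; elim: k => [|k IH]; first exact: Gdominant0.
by rewrite mulrS; apply: GdominantD.
Qed.

Lemma Gdominant_sum (I : Type) (r : seq I) (L : I -> Gweight n) :
  (forall i, Gdominant (L i)) -> Gdominant (\sum_(i <- r) L i).
Proof.
move=> h; elim: r => [|i r IH]; first by rewrite big_nil; apply: Gdominant0.
by rewrite big_cons; apply: GdominantD.
Qed.

Lemma Gdominant_omega i j : Gdominant (omega n i, omega n j).
Proof. by split=> r; rewrite mxE ler0n. Qed.

Lemma Gweight_sum_fst (I : Type) (r : seq I) (L : I -> Gweight n) (m : I -> nat) j :
  (\sum_(i <- r) L i *+ m i).1 0 j = \sum_(i <- r) (L i).1 0 j *+ m i.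
Proof.
elim: r => [|i r IH]; first by rewrite !big_nil mxE.
rewrite !big_cons [_.1]/(( _ *+ _).1 + _) mxE IH; congr (_ + _).
by elim: (m i) => [|k IHk]; rewrite ?mulr0n ?mxE // !mulrS mxE IHk.
Qed.

Lemma Gweight_sum_snd (I : Type) (r : seq I) (L : I -> Gweight n) (m : I -> nat) j :
  (\sum_(i <- r) L i *+ m i).2 0 j = \sum_(i <- r) (L i).2 0 j *+ m i.
Proof.
elim: r => [|i r IH]; first by rewrite !big_nil mxE.
rewrite !big_cons [_.2]/(( _ *+ _).2 + _) mxE IH; congr (_ + _).
by elim: (m i) => [|k IHk]; rewrite ?mulr0n ?mxE // !mulrS mxE IHk.
Qed.

Lemma Bset_spherical k b : Bset n k b ->
  Gdominant b /\ spherical_pair b (omega n 1 *+ k).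
Proof.
move=> [m <- ->]; split.
  by apply: Gdominant_sum => i; apply/GdominantMn/Gdominant_omega.
rewrite -sumrMnr; apply: spherical_pair_sum => i; rewrite mem_index_iota => i1.
by apply: spherical_pairMn; apply: spherical_omega1; lia.
Qed.

Lemma spherical_decomposition k (l : Gweight n) : (0 < n)%N ->
  spherical_pair l (omega n 1 *+ k) ->
  exists b p, [/\ Bset n k b, Gdominant p, spherical_pair p 0 & l = b + p].
Proof.
move=> n0 [F [rF F0 FL FR]].
have hs := regular_subalg (@Gcoord C n).
pose Phi (g : G) := F (g.1, rev_SL C n * g.2)%g.
pose nu : SLweight n := \row_j l.2 0 (rev_ord j).
have rPhi : regular_fun (@Gcoord C n) Phi.
  apply: (@regG_subst C n G _ _ (fun g : G => (g.1, (rev_SL C n * g.2)%g)) hs rF) => i j.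
    exact: regG_fst.
  by apply: subalg_mulmx => // a b; [apply: subalg_const | apply: regG_snd].
have [||||e [se he le]] := @open_orbit_exponents C n n0 Phi l.1 nu k rPhi.
- move=> b x y lb; have := FL (b, 1%g) (x, rev_SL C n * y)%g.
  rewrite /Phi /Gchar /= (Hchar_unip l.2 (b := 1%g)) ?mulr1 => [|i]; last by rewrite slmx1 mxE eqxx.
  move=> <-; last by split=> //; apply: scalar_mx_is_trig.
  by congr F; apply: injective_projections => //=; rewrite mul1g.
- move=> b x y ub; have := FL (1%g, rev_SL C n * b * (rev_SL C n)^-1)%g (x, rev_SL C n * y)%g.
  rewrite /Phi /Gchar /= (Hchar_unip l.1 (b := 1%g)) ?mul1r => [|i]; last by rewrite slmx1 mxE eqxx.
  rewrite Hchar_rev // => <-; last by split; [apply: scalar_mx_is_trig | apply: rev_conj_lower].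
  by congr F; apply: injective_projections; rewrite /= ?mul1g // !mulgA mulgVK.
- move=> h x y uh; rewrite /Phi /=.
  have := FR h (x, rev_SL C n * y)%g uh.
  rewrite HcharMn; last by move=> i; apply: upper_diag_neq0.
  have -> : Hchar (omega n 1) h = h 0 0.
    rewrite Hchar_omega //; last by right.
    rewrite (bigD1 ord0) //= big1 ?mulr1 // => r /andP[r1 /negP[]].
    by apply/eqP/ord_inj => /=; lia.
  by move=> <-; congr F; apply: injective_projections; rewrite /= ?mulgA.
- have [g Fg] := F0; exists (g.1, (rev_SL C n)^-1 * g.2)%g.
  by rewrite /Phi /= mulVKg; case: (g) Fg.
(* The slack of the inequality is the multiplicity of (omega_(j+1), omega_(n-j)). *)
pose p (j : 'I_n) : nat := absz (nu 0 j - (e (node1 j))%:Z)%R.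
have pE j : nu 0 j = (e (node1 j))%:Z + (p j)%:Z.
  by rewrite /p gez0_abs ?subr_ge0 // addrC subrK.
pose P : Gweight n := \sum_(j < n) (omega n j.+1, omega n (n.+1 - j.+1)) *+ p j.
(* Generators are numbered from 1, coordinates from 0. *)
pose k_ i := e (inord i.-1).
pose B : Gweight n := \sum_(1 <= i < n.+2) (omega n i, omega n (n.+2 - i)) *+ k_ i.
exists B, P; split.
- exists k_ => //; rewrite big_add1 big_mkord -[RHS]se; apply: eq_bigr => i _.
  by rewrite /k_ /= inord_val.
- by apply: Gdominant_sum => j; apply/GdominantMn/Gdominant_omega.
- have -> : (0 : SLweight n) = \sum_(j < n) 0 *+ p j.
    by rewrite big1 // => j _; rewrite mul0rn.
  apply: spherical_pair_sum => j _; apply/spherical_pairMn/spherical_invariant.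
  by rewrite ltnS ltnW.
apply: injective_projections; apply/rowP => j.
- rewrite [(B + P).1]/(B.1 + P.1) mxE !Gweight_sum_fst big_add1 big_mkord /=.
  rewrite (bigD1 (node0 j)) //= mxE eqxx big1 ?addr0 => [|i ij]; last first.
    by rewrite mxE eqSS eq_sym (_ : (_ == _ :> nat) = false) ?mul0rn //; apply: negbTE.
  rewrite (bigD1 j) //= mxE eqxx big1 ?addr0 => [|i ij]; last first.
    by rewrite mxE eqSS eq_sym (_ : (_ == _ :> nat) = false) ?mul0rn //; apply: negbTE.
  have := he j; rewrite mxE [in X in _ + X]mxE pE /k_ /= => h.
  rewrite (_ : inord j = node0 j); last by apply: ord_inj; rewrite inordK // ltnS ltnW.
  by rewrite !natz; move: h; lia.
- rewrite [(B + P).2]/(B.2 + P.2) mxE !Gweight_sum_snd big_add1 big_mkord /=.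
  have jn := ltn_ord j.
  (* In the second component omega_(j+1) comes from the coordinate n - j in B and from the index n -
     1 - j in P; the multiplicities add up to nu at n - 1 - j, which is the coefficient of l.2 at
     j. *)
  rewrite (bigD1 (node1 (rev_ord j))) //= mxE big1 ?addr0 => [|i ij]; last first.
    rewrite mxE (_ : (_ == _ :> nat) = false) ?mul0rn //; apply/eqP => h.
    case/negP: ij; apply/eqP/ord_inj; rewrite /= /bump leq0n; have := ltn_ord i; lia.
  rewrite (bigD1 (rev_ord j)) //= mxE big1 ?addr0 => [|i ij]; last first.
    rewrite mxE (_ : (_ == _ :> nat) = false) ?mul0rn //; apply/eqP => h.
    case/negP: ij; apply/eqP/ord_inj; rewrite /=; have := ltn_ord i; lia.
  have := pE (rev_ord j); rewrite mxE rev_ordK => ->.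
  congr (_ + _).
    rewrite /k_ -[bump 0 (n - j.+1)]/(nat_of_ord (node1 (rev_ord j))) inord_val.
    by case: eqP => [_|[]]; [rewrite mulr1n natz | rewrite /= /bump leq0n; lia].
  by case: eqP => [_|[]]; [rewrite mulr1n natz | rewrite /=; lia].
Qed.

End WeightSemigroup.

Local Open Scope classical_set_scope.

Theorem corollary5p3 (R : realType) (n : nat) (hn : (1 <= n)%N) (k : nat) :
  PplusG R[i] (omega n 1 *+ k) =
  [set b + p | b in Bset n k & p in PplusG R[i] (0 : SLweight n)].
Proof.
apply/seteqP; split=> l.
  move=> /PplusG_spherical /(spherical_decomposition hn)[b [p [hb dp [F hF] ->]]].
  by exists b => //; exists p => //; apply: spherical_PplusG hF.
move=> [b /Bset_spherical - /(_ R[i])[db hb] [p hp <-]].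
(* A spherical pair does not record dominance, which is therefore carried along separately. *)
have dp : Gdominant p by case: hp.
have [F hF] := spherical_pairD hb (PplusG_spherical hp).
rewrite addr0 in hF; apply: spherical_PplusG hF; exact: GdominantD.
Qed.
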